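(* Let $k$ be an integer and let $n =\sum_{1 \leqslant i \leqslant k-1}(2^{d_i}-1)$ with $d_1,\ldots,d_{k-1}$ positive integers. If $d_1-d_2\geqslant 2$, $d_{i-1} - d_i \geqslant i-1$ for $3 \leqslant i \leqslant k-1$, and $d_{k-1}\geqslant k-1\geqslant 2$, then $$\dim_{\mathbb F_2} (QP_k)_n = \prod_{1 \leqslant i \leqslant k}(2^i-1).$$
   Context: $P_k=\mathbb F_2[x_1,\ldots,x_k]$ is the polynomial algebra with each $x_j$ of degree $1$, viewed as a module over the mod-2 Steenrod algebra $\mathcal A$ via $Sq^0(x_j)=x_j$, $Sq^1(x_j)=x_j^2$, $Sq^i(x_j)=0$ for $i\geqslant 2$, and the Cartan formula $Sq^n(fg)=\sum_{i=0}^n Sq^i(f)Sq^{n-i}(g)$. $\mathcal A^+$ is the augmentation ideal of $\mathcal A$, $QP_k=P_k/\mathcal A^+P_k$, and $(QP_k)_n$ is the subspace of $QP_k$ of classes represented by homogeneous polynomials of degree $n$. *)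

(* Defs.v *)
From HB Require Import structures.
From mathcomp Require Import all_boot all_order all_algebra.
From mathcomp Require Import generic_quotient ring_quotient boolp.
From mathcomp Require Import mpoly.

Set Implicit Arguments.
Unset Strict Implicit.
Unset Printing Implicit Defensive.

Import GRing.Theory.
Local Open Scope ring_scope.
Local Open Scope quotient_scope.

Notation P k := {mpoly 'F_2[k]}.

(* The total square f |-> \sum_i Sq^i(f) T^i: by the Cartan formula it is the
   ring morphism P_k -> P_k[T] sending x_j to x_j + x_j^2 T. *)
Definition Sq_total (k : nat) (f : P k) : {poly P k} :=
  mmap (polyC \o @mpolyC k 'F_2)
       (fun j : 'I_k => ('X_j)%:P + ('X_j ^+ 2)%:P * 'X) f.

Definition Sq (k i : nat) (f : P k) : P k := (Sq_total f)`_i.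

(* Sq^i is additive, has the prescribed values on the variables and satisfies
   the Cartan formula; these properties determine it. *)
Lemma Sq_is_linear k i : linear (@Sq k i).
Proof.
move=> a f g; rewrite /Sq /Sq_total mmapD coefD mmapZ; congr (_ + _).
by rewrite coefCM; apply: mul_mpolyC.
Qed.

HB.instance Definition _ k i :=
  GRing.isLinear.Build 'F_2 (P k) (P k) _ (@Sq k i) (@Sq_is_linear k i).

Lemma Sq_var k i (j : 'I_k) :
  Sq i ('X_j : P k) =
  if i is 0 then 'X_j else if i is 1 then 'X_j ^+ 2 else 0.
Proof.
rewrite /Sq /Sq_total mmapX mmap1U coefD coefCM coefC coefX.
by case: i => [|[|i]] /=; rewrite ?mulr0 ?mulr1 ?addr0 ?add0r.
Qed.

Lemma Sq_cartan k n (f g : P k) :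
  Sq n (f * g) = \sum_(i < n.+1) Sq i f * Sq (n - i) g.
Proof. by rewrite /Sq /Sq_total -coefM; rewrite rmorphM. Qed.

(* An element of the Steenrod algebra A is the class, modulo the Adem
   relations, of a noncommutative F_2-polynomial in the Sq^i.  Such a
   polynomial is represented as a list of words, the word [:: i1; ..; ir]
   standing for Sq^i1 ... Sq^ir.  It acts on P_k by composing and adding
   operations, and A^+ consists of the classes of the polynomials all of whose
   words have positive degree i1 + ... + ir. *)
Definition steenrod_act (k : nat) (theta : seq (seq nat)) (f : P k) : P k :=
  \sum_(w <- theta) foldr (@Sq k) f w.

Definition in_augmentation_ideal (theta : seq (seq nat)) : bool :=
  all (fun w => 0 < sumn w)%N theta.

(* Membership in A^+ P_k. *)
Definition hit (k : nat) (f : P k) : Prop :=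
  exists2 s : seq (seq (seq nat) * P k),
    all (fun u => in_augmentation_ideal u.1) s &
    f = \sum_(u <- s) steenrod_act u.1 u.2.

Definition hit_pred (k : nat) : P k -> bool := fun f => `[< hit f >].

Lemma F2_scale (V : lmodType 'F_2) (a : 'F_2) (v : V) :
  a *: v = 0 \/ a *: v = v.
Proof.
case: a => [[|[|[]]] // lt_a]; [left | right].
- by rewrite (_ : Ordinal _ = 0) ?scale0r //; apply/val_inj.
- by rewrite (_ : Ordinal _ = 1) ?scale1r //; apply/val_inj.
Qed.

Lemma hit_submod_closed k : submod_closed (@hit_pred k).
Proof.
have hit0 : hit (0 : P k) by exists [::]; rewrite ?big_nil.
split=> [|a f g /asboolP hit_f /asboolP [t at_t gE]]; first exact/asboolP.
have [s as_s aE] : hit (a *: f) by case: (F2_scale a f) => ->.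
apply/asboolP; exists (s ++ t); first by rewrite all_cat as_s.
by rewrite big_cat aE gE.
Qed.

HB.instance Definition _ k :=
  GRing.isSubmodClosed.Build 'F_2 (P k) (@hit_pred k) (@hit_submod_closed k).

Definition QP (k : nat) :=
  Quotient.quot (GRing.ZmodClosed.clone (P k) (@hit_pred k) _).

HB.instance Definition _ k := EqQuotient.on (QP k).
HB.instance Definition _ k := GRing.Zmodule.on (QP k).
HB.instance Definition _ k := ZmodQuotient.on (QP k).

Definition QP_class (k : nat) : P k -> QP k := \pi_(QP k).

Lemma QP_classP k (f g : P k) : QP_class f = QP_class g <-> hit (f - g).
Proof.
split=> [/eqP|h]; first by rewrite -Quotient.idealrBE => /asboolP.
by apply/eqP; rewrite -Quotient.idealrBE; apply/asboolP.
Qed.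

Lemma QP_classD k : {morph @QP_class k : f g / f + g}.
Proof. by move=> f g; rewrite /QP_class; rewrite piE. Qed.

Definition QP_scale (k : nat) (a : 'F_2) (q : QP k) : QP k :=
  QP_class (a *: (repr q : P k)).

Lemma QP_scale_class k a (f : P k) : QP_scale a (QP_class f) = QP_class (a *: f).
Proof.
apply/QP_classP; rewrite -scalerBr; apply/asboolP.
have [hit0 hitP] := hit_submod_closed k.
rewrite -[_ *: _]addr0; apply: hitP hit0.
by apply/asboolP/QP_classP; rewrite /QP_class reprK.
Qed.

Lemma QP_class_surj k (q : QP k) : exists f, q = QP_class f.
Proof. by exists (repr q); rewrite /QP_class reprK. Qed.

Lemma QP_scaleA k a b (q : QP k) :
  QP_scale a (QP_scale b q) = QP_scale (a * b) q.
Proof.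
by have [f ->] := QP_class_surj q; rewrite !QP_scale_class scalerA.
Qed.

Lemma QP_scale1 k : left_id 1 (@QP_scale k).
Proof.
by move=> q; have [f ->] := QP_class_surj q; rewrite QP_scale_class scale1r.
Qed.

Lemma QP_scaleDr k : right_distributive (@QP_scale k) +%R.
Proof.
move=> a q r; have [f ->] := QP_class_surj q; have [g ->] := QP_class_surj r.
by rewrite -QP_classD !QP_scale_class scalerDr QP_classD.
Qed.

Lemma QP_scaleDl k (q : QP k) : {morph (@QP_scale k)^~ q : a b / a + b}.
Proof.
move=> a b; have [f ->] := QP_class_surj q.
by rewrite !QP_scale_class scalerDl QP_classD.
Qed.

HB.instance Definition _ k :=
  GRing.Zmodule_isLmodule.Build 'F_2 (QP k)
    (@QP_scaleA k) (@QP_scale1 k) (@QP_scaleDr k) (@QP_scaleDl k).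

Definition QP_deg (k n : nat) (q : QP k) : Prop :=
  exists2 f : P k, f \is n.-homog & q = QP_class f.

(* The subspace U of V has dimension d.  Stated with a basis because the
   library's \dim needs a finite-dimensional ambient space. *)
Definition has_dim (F : fieldType) (V : lmodType F) (U : V -> Prop) (d : nat) :
    Prop :=
  exists b : 'I_d -> V,
    [/\ forall i, U (b i),
        forall c : 'I_d -> F, \sum_(i < d) c i *: b i = 0 -> forall i, c i = 0
      & forall v, U v -> exists c : 'I_d -> F, v = \sum_(i < d) c i *: b i].

(* Main.v *)
Require Import Defs.
From HB Require Import structures.
From mathcomp Require Import all_boot all_order all_algebra.
From mathcomp Require Import boolp ssrcomplements mpoly zify ring.

Set Implicit Arguments.
Unset Strict Implicit.
Unset Printing Implicit Defensive.

Import GRing.Theory.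
Local Open Scope ring_scope.

(** Write (QP_k)_n^* for the linear functionals on polynomials of degree n in k
   variables that vanish on the image of every Sq^a with a > 0; it is the dual
   of (QP_k)_n, and a basis of it yields one of (QP_k)_n (dual_basis_dim).  Let
   n = (k - 1)(2^s - 1) + 2^s m with s > 0, where m + k - 1 has at least k - 1
   binary digits 1, and where s >= k, or s = k - 1 and m > 0.  Then (QP_k)_n^* is the
   direct sum of copies of (QP_{k-1})_m^*, one for each of the 2^k - 1 nonzero
   linear forms h_J, the sum of the x_j with j in J (dual_basis_step).  Put
   d_k = 0.  Starting from one variable and degree 0, this step is applied for
   k = 2, 3, and so on, the step to k variables having s = d_{k-1} - d_k; the
   dimension is thereby multiplied by 3, by 7, and so on.

   Let X_j be the product of the variables other than x_j.  A functional psi in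
   (QP_k)_m^* that kills the multiples of h_J amounts to an element of
   (QP_{k-1})_m^*, living on the hyperplane h_J = 0.  It spreads to degree
   k - 1 + 2m by sending X_j v^2 to psi(v) for j in J, and every other product
   of a squarefree monomial and a square to 0.  The result is again killed by
   the squares and by h_J (dual_spread, kills_form_spread), so spreading can be
   iterated s times.

   Conversely let phi be in (QP_k)_n^*.  By the chi-trick, phi vanishes on
   x_I v^2 when x_I is squarefree of degree less than k - 1 (dual_low).  Hence
   phi is determined by its strands phi_j(v) = phi(X_j v^2), which kill the
   squares again, and Sq^1(x_1...x_k v^2) gives the relation
   sum_j phi_j(x_j v) = 0.  Taking strands s times attaches to each word w of
   length s a functional of degree m.  The relation, applied to suitable v,
   shows that it depends only on the set S of letters of w (strands_support);
   call it phi_S.  It also says that sum_j phi_{S + j}(x_j v) = 0 for all S,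
   and modulo 2 this means that psi_J, the sum of the phi_S over the S
   containing J, kills h_J.  Since phi_S is the sum of the psi_J over the J
   containing S, phi is the sum of the iterated spreads of the psi_J
   (dual_decomposition).

   If s = k - 1 then no word uses all k letters.  The functional phi_S for the
   full set S is then obtained by prescribing its values on the multiples of
   each variable.  The prescriptions agree because phi also kills the image of
   the Milnor primitive Q_1, the derivation taking each x_j to x_j^4
   (complete_family). *)

(** * Squares in characteristic 2 *)

Section Characteristic2.
Variable R : comNzRingType.
Hypothesis charR : 2%N \in [pchar R].

Lemma sqrD2 (x y : R) : (x + y) ^+ 2 = x ^+ 2 + y ^+ 2.
Proof. by rewrite sqrrD mulr2n (addrr_pchar2 charR) addr0. Qed.

Lemma sqr_sum2 (I : Type) (r : seq I) (A : pred I) (F : I -> R) :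
  (\sum_(i <- r | A i) F i) ^+ 2 = \sum_(i <- r | A i) F i ^+ 2.
Proof. by elim/big_rec2: _ => [|i x y _ <-]; rewrite ?expr0n ?sqrD2. Qed.

Lemma pchar_poly2 : 2%N \in [pchar {poly R}].
Proof. by rewrite inE /= -polyC_natr (pcharf0 charR) polyC0 eqxx. Qed.

Lemma coef_sqr2 (p : {poly R}) a :
  (p ^+ 2)`_a = if odd a then 0 else p`_a./2 ^+ 2.
Proof.
elim/poly_ind: p a => [|p c IH] a.
  by rewrite expr0n !coef0 expr0n if_same.
have -> : (p * 'X + c%:P) ^+ 2 = p ^+ 2 * 'X * 'X + (c ^+ 2)%:P.
  by rewrite sqrrD mulr2n (addrr_pchar2 pchar_poly2) addr0 exprMn expr2 mulrA polyC_exp.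
rewrite !coefD !coefMX !coefC; case: a => [|[|a]] //=; rewrite ?add0r ?addr0 //.
by rewrite IH negbK.
Qed.

End Characteristic2.

(** * Functionals given by their values on monomials *)
Section Functionals.
Variable k : nat.
Implicit Types (f g v : P k) (m : 'X_{1..k}) (I C : {set 'I_k}).

Lemma pcharP : 2%N \in [pchar P k].
Proof. by rewrite inE /= -mpolyC_nat (pcharf0 (pchar_Fp (isT : prime 2))) mpolyC0 eqxx. Qed.

Lemma addff f : f + f = 0. Proof. exact: addrr_pchar2 pcharP f. Qed.

Lemma addF2 (x : 'F_2) : x + x = 0.
Proof. exact: addrr_pchar2 (pchar_Fp (isT : prime 2)) x. Qed.

Lemma addF2_eq0 (x y : 'F_2) : (x + y == 0) = (x == y).
Proof. by rewrite addr_eq0 (oppr_pchar2 (pchar_Fp (isT : prime 2))). Qed.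

Lemma F2_cases (x : 'F_2) : x = 0 \/ x = 1.
Proof. by case: x => [[|[|[]]] // h]; [left | right]; apply/val_inj. Qed.

Lemma F2_mpoly_ind (Q : P k -> Prop) :
  Q 0 -> (forall m f, Q f -> Q ('X_[m] + f)) -> forall f, Q f.
Proof.
move=> Q0 QD; elim/mpolyind => // c m f _ c0 Qf.
by case: (F2_cases c) c0 => ->; rewrite ?eqxx // scale1r => _; apply: QD.
Qed.

Definition functional := 'X_{1..k} -> 'F_2.
Implicit Types phi psi : functional.

Definition ev phi f : 'F_2 := \sum_(m <- msupp f) f@_m * phi m.

Lemma evE phi f d : (msize f <= d)%N ->
  ev phi f = \sum_(m : 'X_{1..k < d}) f@_m * phi m.
Proof.
move=> le_fd; rewrite /ev (big_mksub ('X_{1..k < d} : subFinType _)) ?msupp_uniq //=.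
  by rewrite big_rmcond //= => j /memN_msupp_eq0 ->; rewrite mul0r.
by move=> x /msize_mdeg_lt /leq_trans; apply.
Qed.

Fact ev_is_scalar phi : scalar (ev phi).
Proof.
move=> a f g; set d := maxn (msize (a *: f + g)) (maxn (msize f) (msize g)).
rewrite !(@evE _ _ d) ?leq_max ?leqnn ?orbT //.
rewrite mulr_sumr -big_split; apply: eq_bigr => m _ /=.
by rewrite mcoeffD mcoeffZ mulrDl mulrA.
Qed.

HB.instance Definition _ phi :=
  GRing.isLinear.Build 'F_2 (P k) 'F_2 *%R (ev phi) (ev_is_scalar phi).

Lemma evX phi m : ev phi 'X_[m] = phi m.
Proof. by rewrite /ev msuppX big_seq1 mcoeffX eqxx mul1r. Qed.

Lemma ev_ext phi psi : phi =1 psi -> ev phi =1 ev psi.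
Proof. by move=> E f; apply: eq_bigr => m _; rewrite E. Qed.

Lemma ev_zero f : ev (fun=> 0) f = 0.
Proof. by apply: big1 => m _; rewrite mulr0. Qed.

Lemma ev_sum (T : Type) (r : seq T) (A : pred T) (F : T -> functional) f :
  ev (fun m => \sum_(t <- r | A t) F t m) f = \sum_(t <- r | A t) ev (F t) f.
Proof. by rewrite exchange_big; apply: eq_bigr => m _; rewrite mulr_sumr. Qed.

Lemma ev_scale c phi f : ev (fun m => c * phi m) f = c * ev phi f.
Proof. by rewrite mulr_sumr; apply: eq_bigr => m _; rewrite mulrCA. Qed.

Lemma ev_eqX phi (F : P k -> 'F_2) : {morph F : f g / f + g} ->
  (forall m, phi m = F 'X_[m]) -> forall f, ev phi f = F f.
Proof.
move=> FD FX; elim/F2_mpoly_ind => [|m f IH]; last by rewrite raddfD /= evX FD FX IH.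
by rewrite raddf0; apply: (addrI (F 0)); rewrite -FD !addr0.
Qed.

(** * Slices along squarefree monomials *)

Definition sqfree I : 'X_{1..k} := [multinom (i \in I : nat) | i < k].
Definition odds m : {set 'I_k} := [set i | odd (m i)].
Definition halfm m : 'X_{1..k} := [multinom (m i)./2 | i < k].

Lemma oddsE I m : odds (sqfree I + m *+ 2)%MM = I.
Proof.
apply/setP => i; rewrite inE mnmDE mulmnE mnmE oddD oddM andbF addbF.
by case: (i \in I).
Qed.

Lemma halfmE I m : halfm (sqfree I + m *+ 2)%MM = m.
Proof.
by apply/mnmP => i; rewrite mnmE mnmDE mulmnE mnmE muln2 half_bit_double.
Qed.

Lemma parityE m : (sqfree (odds m) + halfm m *+ 2)%MM = m.
Proof.
by apply/mnmP => i; rewrite mnmDE mulmnE !mnmE inE muln2 odd_double_half.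
Qed.

Lemma mnm_factor m : m != 0%MM -> exists i m', m = (U_(i) + m')%MM.
Proof.
move=> m0; have [i mi] : exists i, m i != 0%N.
  apply/existsP; apply: contraTT m0 => /existsPn H; rewrite negbK.
  by apply/eqP/mnmP => i; rewrite mnm0E; apply/eqP; rewrite -[_ == _]negbK.
by exists i, (m - U_(i))%MM; rewrite addmC submK // lep1mP.
Qed.

Lemma mdeg_sqfree I : mdeg (sqfree I) = #|I|.
Proof.
by rewrite mdegE -sum1_card [RHS]big_mkcond; apply: eq_bigr => i _; rewrite mnmE; case: ifP.
Qed.

Lemma sqfree_setU1 I i : i \notin I -> sqfree (i |: I) = (sqfree I + U_(i))%MM.
Proof.
move=> iI; apply/mnmP => j; rewrite mnmDE mnmE mnm1E mnmE in_setU1 eq_sym.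
by case: eqP iI => [->|] /=; case: (j \in I).
Qed.

Lemma sqfree_set1 i : sqfree [set i] = U_(i)%MM.
Proof. by apply/mnmP => j; rewrite mnmE mnm1E in_set1 eq_sym. Qed.

Lemma sqfree_set0 : sqfree set0 = 0%MM.
Proof. by apply/mnmP => j; rewrite mnmE mnm0E inE. Qed.

Definition slice phi I : functional := fun m => phi (sqfree I + m *+ 2)%MM.

Lemma ev_slice phi I v : ev (slice phi I) v = ev phi ('X_[sqfree I] * v ^+ 2).
Proof.
apply: (ev_eqX (F := fun v => ev phi ('X_[sqfree I] * v ^+ 2))) => [f g|m].
  by rewrite (sqrD2 pcharP) mulrDr raddfD.
by rewrite mpolyXn -mpolyXD evX.
Qed.

Lemma slice_ext phi psi : (forall I, slice phi I =1 slice psi I) -> phi =1 psi.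
Proof. by move=> E m; rewrite -(parityE m); apply: E. Qed.

(** * The squares on products x_I v^2 *)

HB.instance Definition _ :=
  GRing.RMorphism.copy (@Sq_total k)
    (mmap (polyC \o @mpolyC k 'F_2)
       (fun j : 'I_k => ('X_j)%:P + ('X_j ^+ 2)%:P * 'X)).

Lemma Sq_totalX i : Sq_total ('X_i : P k) = ('X_i)%:P + ('X_i ^+ 2)%:P * 'X.
Proof. by rewrite /Sq_total mmapX mmap1U. Qed.

Lemma Xsqfree I : 'X_[sqfree I] = \prod_(i in I) 'X_i :> P k.
Proof.
rewrite mpolyXE_id [RHS]big_mkcond; apply: eq_bigr => i _; rewrite mnmE.
by case: ifP.
Qed.

Lemma Sq_total_sqfree I : Sq_total ('X_[sqfree I] : P k) =
  \sum_(C : {set 'I_k} | C \subset I)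
    ('X_[sqfree (I :\: C)] * 'X_[sqfree C] ^+ 2)%:P * 'X^#|C|.
Proof.
rewrite Xsqfree rmorph_prod /= big_mkcond /=.
pose F i : {poly P k} := if i \in I then ('X_i ^+ 2)%:P * 'X else 0.
pose G i : {poly P k} := if i \in I then ('X_i)%:P else 1.
rewrite (eq_bigr (fun i => F i + G i)) => [|i _]; last first.
  rewrite /F /G; case: (i \in I); last by rewrite add0r.
  by rewrite Sq_totalX addrC.
rewrite bigA_distr [RHS]big_mkcond /=; apply: eq_bigr => C _.
case: ifP => [CI|/negbT]; last first.
  case/subsetPn => i iC iI; rewrite (bigD1 i) //= iC /F (negPf iI).
  by rewrite mul0r.
rewrite !Xsqfree -prodrXl.
transitivity (\prod_i ((if i \in I :\: C then ('X_i)%:P else 1) *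
   (if i \in C then ('X_i ^+ 2)%:P * 'X else 1) : {poly P k})).
  apply: eq_bigr => i _; rewrite /F /G inE.
  have [iC|iC] /= := boolP (i \in C); last by rewrite mulr1.
  by rewrite (subsetP CI) // mul1r.
rewrite big_split /= -!big_mkcond /= rmorphM !rmorph_prod /= big_split /=.
by rewrite prodr_const mulrA.
Qed.

(** The total square of v^2 is the square of that of v, so in characteristic 2
   it has even powers of the grading variable only; the part of odd degree comes
   from x_I, each variable of which is squared or not. *)
Lemma Sq_sqfree_sqr a I v : Sq a ('X_[sqfree I] * v ^+ 2) =
  \sum_(C : {set 'I_k} | [&& C \subset I, #|C| <= a & ~~ odd (a - #|C|)]%N)
    'X_[sqfree (I :\: C)] * ('X_[sqfree C] * Sq (a - #|C|)./2 v) ^+ 2.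
Proof.
rewrite /Sq rmorphM rmorphXn /= Sq_total_sqfree mulr_suml coef_sum.
rewrite !big_mkcondr /=; apply: eq_bigr => C _.
rewrite -mulrA coefCM coefXnM (coef_sqr2 pcharP) ltnNge.
case: (#|C| <= a)%N => /=; last by rewrite mulr0.
case: (odd _) => /=; first by rewrite mulr0.
by rewrite exprMn -mulrA.
Qed.

Lemma ev_Sq phi a I v : ev phi (Sq a ('X_[sqfree I] * v ^+ 2)) =
  \sum_(C : {set 'I_k} | [&& C \subset I, #|C| <= a & ~~ odd (a - #|C|)]%N)
    ev (slice phi (I :\: C)) ('X_[sqfree C] * Sq (a - #|C|)./2 v).
Proof.
by rewrite Sq_sqfree_sqr raddf_sum; apply: eq_bigr => C _; rewrite ev_slice.
Qed.

Lemma Sq_0 f : Sq 0 f = f.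
Proof.
elim/F2_mpoly_ind: f => [|m f IH]; first by rewrite raddf0.
rewrite raddfD /= IH; congr (_ + _); rewrite mpolyXE_id.
elim/big_rec: _ => [|i x _ IHx]; first by rewrite /Sq rmorph1 coefC.
rewrite Sq_cartan big_ord1 subn0 IHx; congr (_ * _).
elim: (m i) => [|e IHe]; first by rewrite /Sq rmorph1 coefC.
by rewrite exprS Sq_cartan big_ord1 IHe Sq_var.
Qed.

Lemma Sq_1 a : (0 < a)%N -> Sq a (1 : P k) = 0.
Proof. by case: a => // a _; rewrite /Sq rmorph1 coefC. Qed.

End Functionals.

(** * Sums of binary digits *)

Fixpoint popcount_rec fuel n : nat :=
  if fuel is f.+1 then odd n + popcount_rec f n./2 else 0.
Definition popcount n : nat := popcount_rec n n.

Lemma popcount_recE f n : (n <= f)%N -> popcount_rec f n = popcount n.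
Proof.
rewrite /popcount; move: {-2}f (leqnn f) => g.
elim: f g n => [|f IH] [|g] [|n] //= lefg; rewrite ?ltnS => le_ng //.
- have H : forall l, popcount_rec l 0 = 0%N by elim=> //= l ->.
  by rewrite H.
congr (_ + _)%N; rewrite IH ?IH //; lia.
Qed.

Lemma popcountE n : popcount n = (odd n + popcount n./2)%N.
Proof.
by case: n => // n; rewrite {1}/popcount /= popcount_recE //; lia.
Qed.

Lemma popcount_double n : popcount n.*2 = popcount n.
Proof. by rewrite popcountE odd_double doubleK. Qed.

Lemma popcount_doubleS n : popcount n.*2.+1 = (popcount n).+1.
Proof. by rewrite popcountE /= odd_double uphalf_double. Qed.

Lemma popcount_exp b n : popcount (2 ^ b * n) = popcount n.
Proof. by elim: b => [|b IH]; rewrite ?mul1n // expnS -mulnA mul2n popcount_double. Qed.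

Lemma popcountD a b : (popcount (a + b) <= popcount a + popcount b)%N.
Proof.
have [n] := ubnP (a + b)%N; elim: n a b => // n IH a b lt_n.
have [->|a0] := posnP a; first by rewrite add0n leq_addl.
have [->|b0] := posnP b; first by rewrite addn0 leq_addr.
rewrite (popcountE (a + b)) (popcountE a) (popcountE b) oddD halfD.
have := IH a./2 b./2; have := IH a./2 b./2.+1; have := IH b./2 1%N.
rewrite addn1 (_ : popcount 1 = 1)%N //.
have := odd_double_half a; have := odd_double_half b.
case: (odd a); case: (odd b) => /=; rewrite ?add0n ?add1n ?addnS;
  set x := popcount _; set y := popcount _; lia.
Qed.

Lemma popcount_le n : (popcount n <= n)%N.
Proof.
elim: n => // n IH; rewrite -addn1; apply: leq_trans (popcountD _ _) _.
by rewrite leq_add.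
Qed.

Lemma popcount_lt n : (1 < n)%N -> (popcount n < n)%N.
Proof.
case: n => [|[|n]] // _; rewrite -addn2; apply: leq_ltn_trans (popcountD _ _) _.
by rewrite (_ : popcount 2 = 1)%N // addn1 addn2 !ltnS popcount_le.
Qed.

Lemma popcount_sum (I : finType) (A : pred I) (b : I -> nat) :
  (popcount (\sum_(i | A i) 2 ^ b i) <= #|A|)%N.
Proof.
rewrite -sum1_card; elim/big_rec2: _ => // i x y _ le_yx.
apply: leq_trans (popcountD _ _) _; rewrite leq_add //.
by rewrite -[(2 ^ _)%N]muln1 popcount_exp.
Qed.

(** * The dual of the space of classes *)

Section Annihilator.
Variable k : nat.
Implicit Types (f g v : P k) (m : 'X_{1..k}) (I J C : {set 'I_k}).
Implicit Types phi psi : functional k.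

Definition kills_Sq phi := forall a f, (0 < a)%N -> ev phi (Sq a f) = 0.
(** A functional on polynomials of degree n is extended by 0 to all degrees.
   Killing the Sq^a with a > 0 amounts to killing all hit polynomials, since a
   word of positive degree has a letter a > 0. *)
Definition QP_dual n phi := (forall m, mdeg m <> n -> phi m = 0) /\ kills_Sq phi.

Lemma ev_X_eq0 phi (F : P k -> P k) : {morph F : f g / f + g} ->
  (forall I m, ev phi (F ('X_[sqfree I] * 'X_[m] ^+ 2)) = 0) ->
  forall f, ev phi (F f) = 0.
Proof.
move=> FD H; elim/F2_mpoly_ind => [|m f IH].
  by rewrite [F 0](_ : _ = 0) ?raddf0 //; apply: (addrI (F 0)); rewrite -FD !addr0.
rewrite FD raddfD /= IH addr0 -(parityE m) mpolyXD -mpolyXn; exact: H.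
Qed.

Lemma dual_ext n phi psi : phi =1 psi -> QP_dual n phi -> QP_dual n psi.
Proof.
move=> E [phi_n phiS]; split=> [m mn|a f a0]; first by rewrite -E phi_n.
by rewrite -(ev_ext E) phiS.
Qed.

Lemma dual0 n : QP_dual n (fun=> 0 : 'F_2).
Proof. by split=> // a f _; rewrite ev_zero. Qed.

Lemma dual_sum n (T : Type) (r : seq T) (A : pred T) (F : T -> functional k) :
  (forall t, A t -> QP_dual n (F t)) -> QP_dual n (fun m => \sum_(t <- r | A t) F t m).
Proof.
move=> H; split=> [m mn|a f a0]; first by apply: big1 => t /H[-> //].
by rewrite ev_sum; apply: big1 => t /H[_ ->].
Qed.

Lemma dualD n phi psi : QP_dual n phi -> QP_dual n psi -> QP_dual n (fun m => phi m + psi m).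
Proof.
move=> Dphi Dpsi.
have := @dual_sum n bool (index_enum bool) xpredT (fun b => if b then phi else psi).
have E : (fun m => \sum_(b : bool) (if b then phi else psi) m) =1 (fun m => phi m + psi m).
  by move=> m; rewrite big_bool.
by move=> H; apply: dual_ext E (H _) => -[].
Qed.

Lemma dual_scale n c phi : QP_dual n phi -> QP_dual n (fun m => c * phi m).
Proof.
move=> [phi_n phiS]; split=> [m mn|a f a0]; first by rewrite phi_n ?mulr0.
by rewrite ev_scale phiS ?mulr0.
Qed.

(** The hypothesis on f holds for variables and, more generally, for sums of
   variables. *)
Lemma Sq_total_linear (f g : P k) :
  Sq_total f = f%:P + (f ^+ 2)%:P * 'X ->
  forall a, Sq a.+1 (f * g) = f * Sq a.+1 g + f ^+ 2 * Sq a g.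
Proof.
move=> Ef a; rewrite /Sq rmorphM /= Ef mulrDl coefD coefCM -mulrA coefCM.
by rewrite coefXM.
Qed.

Definition linform J : P k := \sum_(j in J) 'X_j.

Lemma Sq_linform J : Sq_total (linform J) = (linform J)%:P + (linform J ^+ 2)%:P * 'X.
Proof.
rewrite /linform (sqr_sum2 (@pcharP k)) !rmorph_sum /= mulr_suml -big_split.
by apply: eq_bigr => j _; rewrite Sq_totalX.
Qed.

Lemma Sq_X_deg m : Sq (mdeg m) ('X_[m] : P k) = 'X_[m] ^+ 2 /\
  forall a, (mdeg m < a)%N -> Sq a ('X_[m] : P k) = 0.
Proof.
move: {2}(mdeg m) (erefl (mdeg m)) => d; elim: d m => [|d IH] m md.
  have -> : m = 0%MM by apply/eqP; rewrite -mdeg_eq0 md.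
  rewrite mdeg0 mpolyX0 Sq_0 expr1n; split=> // a a0; exact: Sq_1.
have [|i [m' Em]] := @mnm_factor _ m; first by rewrite -mdeg_eq0 md.
move: md; rewrite Em mdegD mdeg1 add1n => -[md].
have [top over] := IH _ md; rewrite mpolyXD.
have E := Sq_total_linear _ (Sq_totalX i).
split=> [|[|a]] //; first by rewrite E over // mulr0 add0r top exprMn.
by rewrite ltnS => lt_a; rewrite E !over ?mulr0 ?addr0 // ltnW.
Qed.

(** * The chi-trick *)

Lemma prod_coef_low (A : seq 'I_k) (a b : 'I_k -> P k) M :
  exists R : {poly P k},
    \prod_(i <- A) ((a i)%:P + (b i)%:P * 'X^M) = (\prod_(i <- A) a i)%:P + R * 'X^M.
Proof.
elim: A => [|i A [R E]]; first by exists 0; rewrite !big_nil mul0r addr0.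
rewrite !big_cons E; exists ((a i)%:P * R + (b i)%:P * ((\prod_(i <- A) a i)%:P + R * 'X^M)).
rewrite rmorphM /=; move: ('X^M) (_%:P) (_%:P) (_%:P) => x y z t; ring.
Qed.

(** The total square extended to polynomials in the grading variable T, with T
   fixed.  A functional of the dual sees the coefficient of T^d in the result
   as that of T^d in F. *)
Definition Sq_ext (F : {poly P k}) : {poly P k} :=
  (map_poly (@Sq_total k) F).['X].

Lemma Sq_extM F G : Sq_ext (F * G) = Sq_ext F * Sq_ext G.
Proof. by rewrite /Sq_ext rmorphM hornerM. Qed.

Lemma Sq_extD F G : Sq_ext (F + G) = Sq_ext F + Sq_ext G.
Proof. by rewrite /Sq_ext rmorphD hornerD. Qed.

Lemma Sq_ext1 : Sq_ext 1 = 1.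
Proof. by rewrite /Sq_ext rmorph1 hornerC. Qed.

Lemma Sq_extC f : Sq_ext f%:P = Sq_total f.
Proof. by rewrite /Sq_ext map_polyC hornerC. Qed.

Lemma coef_Sq_ext F d : (Sq_ext F)`_d = \sum_(j < d.+1) Sq (d - j) F`_j.
Proof.
rewrite /Sq_ext (@horner_coef_wide _ (maxn (size F) d.+1)); last first.
  by apply: leq_trans (size_poly _ _) _; rewrite leq_maxl.
rewrite coef_sum.
under eq_bigr do rewrite coef_map coefMXn.
rewrite (big_ord_widen _ (fun j => Sq (d - j) F`_j) (leq_maxr (size F) d.+1)).
rewrite [RHS]big_mkcond; apply: eq_bigr => j _ /=.
by rewrite ltnS ltnNge; case: leqP.
Qed.

(** A truncation of the antipode of the total square, evaluated at a variable. *)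
Definition conj_var N i : {poly P k} :=
  \sum_(a < N) ('X_i ^+ (2 ^ a))%:P * 'X^(2 ^ a - 1).

(** Telescoping: the total square of x^(2^a) is x^(2^a) + x^(2^(a+1)) T^(2^a),
   whose second term cancels against the next summand. *)
Lemma Sq_ext_conj N i :
  Sq_ext (conj_var N i) = ('X_i)%:P + ('X_i ^+ (2 ^ N))%:P * 'X^(2 ^ N - 1).
Proof.
elim: N => [|N IH].
  rewrite /conj_var big_ord0 /Sq_ext rmorph0 horner0 expr1 expr0 mulr1.
  by rewrite -rmorphD addff.
have -> : conj_var N.+1 i = conj_var N i + ('X_i ^+ (2 ^ N))%:P * 'X^(2 ^ N - 1).
  by rewrite /conj_var big_ord_recr.
rewrite Sq_extD IH Sq_extM Sq_extC.
have -> : Sq_ext 'X^(2 ^ N - 1) = 'X^(2 ^ N - 1).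
  by rewrite /Sq_ext map_polyXn hornerXn.
have -> : Sq_total ('X_i ^+ (2 ^ N) : P k) =
    ('X_i ^+ (2 ^ N))%:P + ('X_i ^+ (2 ^ N.+1))%:P * 'X^(2 ^ N).
  rewrite rmorphXn /= Sq_totalX exprDn_pchar.
    by rewrite exprMn -!rmorphXn /= -exprM -expnS.
  by rewrite pnatX pnatE // (pchar_poly2 (@pcharP k)).
rewrite mulrDl -mulrA -exprD addrACA addrA.
rewrite -[X in X + _ = _]addrA (addrr_pchar2 (pchar_poly2 (@pcharP k))) addr0.
congr (_ + _ * 'X^_).
by rewrite expnS mul2n -addnn addnBA // expn_gt0.
Qed.

(** With d = deg v one has v^2 = Sq^d(v).  Multiplying v by the antipodes of the
   variables of x_I and taking the total square gives x_I times that of v, up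
   to powers of T above d; so modulo hit polynomials x_I v^2 is the coefficient
   of T^d in the product of the antipodes, times v.  Only sums of #|I| numbers
   2^b - 1 occur as exponents of T in that product. *)
Lemma chi_trick phi I m : kills_Sq phi ->
  (forall b : 'I_k -> nat, mdeg m <> (\sum_(i in I) (2 ^ b i - 1))%N) ->
  slice phi I m = 0.
Proof.
move=> phiS d_neq; set d := mdeg m in d_neq.
pose F := (\prod_(i in I) conj_var d.+1 i) * ('X_[m])%:P.
have Fd : F`_d = 0.
  rewrite /F coefMC; apply/eqP; rewrite mulf_eq0; apply/orP; left; apply/eqP.
  rewrite /conj_var (big_distr_big (ord0 : 'I_d.+1)).
  rewrite coef_sum; apply: big1 => b _; rewrite big_split /= -rmorph_prod /=.
  rewrite coefCM -(big_morph _ (exprD 'X) (expr0 _)) coefXn.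
  by case: eqP => [/d_neq|]; rewrite ?mulr0.
have E1 : ev phi (Sq_ext F)`_d = 0.
  rewrite coef_Sq_ext big_ord_recr /= Fd !raddf0 addr0 raddf_sum /=.
  by apply: big1 => j _; rewrite phiS // subn_gt0.
have E2 : (Sq_ext F)`_d = 'X_[sqfree I] * 'X_[m] ^+ 2.
  rewrite /F Sq_extM Sq_extC.
  have -> : Sq_ext (\prod_(i in I) conj_var d.+1 i) =
     \prod_(i in I) (('X_i)%:P + ('X_i ^+ (2 ^ d.+1))%:P * 'X^(2 ^ d.+1 - 1)).
    rewrite (big_morph Sq_ext Sq_extM Sq_ext1).
    by apply: eq_bigr => i _; rewrite Sq_ext_conj.
  rewrite -big_enum /=; have [R ->] := prod_coef_low (enum I)
     (fun i => 'X_i) (fun i => 'X_i ^+ (2 ^ d.+1)) (2 ^ d.+1 - 1).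
  rewrite mulrDl -mulrA coefD coefCM [X in _ + X](_ : _ = 0) ?addr0.
    by rewrite big_enum -Xsqfree -/(Sq d _) (Sq_X_deg m).1.
  rewrite mulrCA coefXnM ifT //.
  by rewrite ltn_subRL add1n ltn_expl.
by rewrite -evX ev_slice -E2.
Qed.

(** If the slice at I is not zero, the chi-trick makes n + #|I| a sum of #|I|
   powers of 2.  Subadditivity of the digit sum then gives
   k - 1 - #|I| <= popcount (k - 1 - #|I|), hence k - 1 - #|I| <= 1, and
   k - 1 - #|I| = 1 is excluded by the parity of n. *)
Lemma dual_low n d phi I m : n = (k.-1 + d.*2)%N ->
  (k.-1 <= popcount (n + k.-1))%N -> QP_dual n phi -> (#|I| < k.-1)%N ->
  slice phi I m = 0.
Proof.
move=> n_def pc [phi_n phiS] ltI.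
have [deg|/eqP deg] := eqVneq (mdeg (sqfree I + m *+ 2)%MM) n; last exact: phi_n.
move: deg; rewrite mdegD mdegMn mdeg_sqfree => deg.
apply: chi_trick => // b mE.
have E : (n + #|I| = \sum_(i in I) 2 ^ (b i).+1)%N.
  rewrite -deg mE muln2 -addnn.
  under [in RHS]eq_bigr do rewrite expnS mul2n -addnn.
  have H : (#|I| + \sum_(i in I) (2 ^ b i - 1) = \sum_(i in I) 2 ^ b i)%N.
    rewrite -sum1_card -big_split; apply: eq_bigr => i _ /=.
    by rewrite subnKC // expn_gt0.
  rewrite big_split /= -H.
  by rewrite addnAC [RHS]addnACA.
have pcI : (popcount (n + #|I|) <= #|I|)%N by rewrite E; apply: popcount_sum.
have := popcountD (n + #|I|) (k.-1 - #|I|).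
have -> : (n + #|I| + (k.-1 - #|I|) = n + k.-1)%N by lia.
have [lt1|] := ltnP 1 (k.-1 - #|I|); last by lia.
by have := popcount_lt lt1; lia.
Qed.

End Annihilator.

(** * Spreading a functional from a hyperplane *)
Section Lift.
Variable k : nat.
Implicit Types (f g v : P k) (m : 'X_{1..k}) (I J C : {set 'I_k}).
Implicit Types phi psi : functional k.

Lemma ev_mulX phi j I v : ev phi ('X_j * ('X_[sqfree I] * v ^+ 2)) =
  if j \in I then ev (slice phi (I :\ j)) ('X_j * v) else ev (slice phi (j |: I)) v.
Proof.
case: ifP => [jI|/negbT jI]; rewrite ev_slice; congr ev; last first.
  by rewrite sqfree_setU1 // mpolyXD mulrA ['X_j * _]mulrC.
have -> : sqfree I = (sqfree (I :\ j) + U_(j))%MM.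
  by rewrite -sqfree_setU1 ?setD1K // in_setD1 eqxx.
by rewrite mpolyXD exprMn; ring.
Qed.

Definition kills_form J phi := forall v, ev phi (linform J * v) = 0.

Lemma kills_formX J phi :
  (forall I m, ev phi (linform J * ('X_[sqfree I] * 'X_[m] ^+ 2)) = 0) ->
  kills_form J phi.
Proof. by move=> H; apply: (ev_X_eq0 (F := *%R (linform J))) => // f g; apply: mulrDr. Qed.

Definition singles J : {set {set 'I_k}} := [set [set j] | j in J].

Lemma in_singles J j : ([set j] \in singles J) = (j \in J).
Proof. by rewrite mem_imset // => x y; apply: set1_inj. Qed.

Lemma card_singles J C : C \in singles J -> #|C| = 1%N.
Proof. by case/imsetP => j _ ->; rewrite cards1. Qed.

Lemma sum_singles J (F : {set 'I_k} -> 'F_2) :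
  \sum_(C in singles J) F C = \sum_(j in J) F [set j].
Proof. by rewrite big_imset // => x y _ _; apply: set1_inj. Qed.

(** The functional sending X_j v^2, where X_j is the product of the variables
   other than x_j, to psi v when j is in J, and every other x_I v^2 to 0. *)
Definition spread J psi : functional k :=
  fun m => if ~: odds m \in singles J then psi (halfm m) else 0.

Lemma slice_spread J psi I m :
  slice (spread J psi) I m = if ~: I \in singles J then psi m else 0.
Proof. by rewrite /slice /spread oddsE halfmE. Qed.

Lemma ev_slice_spread J psi I v :
  ev (slice (spread J psi) I) v = if ~: I \in singles J then ev psi v else 0.
Proof.
rewrite (ev_ext (slice_spread J psi I)).
by case: ifP => _; rewrite ?ev_zero.
Qed.

(** Two kinds of terms of Sq^a(x_I v^2) have exactly one even exponent.  If I
   misses one variable, no variable of x_I is squared, and psi is evaluated at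
   Sq^(a/2) v.  If I is full, one x_j is squared, and the sum over the j in J
   is psi(h_J Sq^b v) = 0. *)
Lemma dual_spread J n psi : QP_dual n psi -> kills_form J psi ->
  QP_dual (k.-1 + n.*2) (spread J psi).
Proof.
move=> [psi_n psiS] psiJ; split=> [m mn|a f a0].
  rewrite /spread; case: ifP => // /card_singles c1; apply: psi_n => mn'; apply: mn.
  rewrite -(parityE m) mdegD mdegMn mdeg_sqfree mn' -muln2.
  by have := cardsC (odds m); rewrite c1 card_ord; lia.
move: f; apply: (ev_X_eq0 (raddfD (@Sq k a))) => I m; rewrite ev_Sq.
under eq_bigr do rewrite ev_slice_spread setCD.
have [I1|I1] := eqVneq (~: I) set0.
  rewrite big_mkcond /=.
  pose G C := if (#|C| <= a)%N && ~~ odd (a - #|C|)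
    then ev psi ('X_[sqfree C] * Sq (a - #|C|)./2 'X_[m]) else 0.
  rewrite (eq_bigr (fun C => if C \in singles J then G C else 0)) => [|C _].
    rewrite -big_mkcond sum_singles /G; under eq_bigr do rewrite cards1 sqfree_set1.
    rewrite a0 /=; case: (odd _) => /=; first by rewrite big1.
    by rewrite -raddf_sum -mulr_suml; apply: psiJ.
  rewrite I1 set0U /G (_ : C \subset I); last first.
    by rewrite -(setCK I) I1 setC0 subsetT.
  by rewrite /=; case: (C \in singles J); case: (_ && _).
apply: big1 => C /and3P[CI Ca aC]; case: ifP => // cIC.
have [C0|[x xC]] := set_0Vmem C.
  rewrite C0 cards0 subn0 sqfree_set0 mpolyX0 mul1r psiS //.
  by move: aC; rewrite C0 cards0; lia.
have [y yI] := set0Pn _ I1.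
have /card_singles/eqP/cards1P [z E] := cIC.
have : x \in [set z] by rewrite -E in_setU xC orbT.
have : y \in [set z] by rewrite -E in_setU yI.
rewrite !in_set1 => /eqP yz /eqP xz; move: yI.
by rewrite yz -xz inE (subsetP CI).
Qed.

(** This allows spreading to be iterated.  If x_I lacks exactly two variables,
   both in J, multiplication by h_J supplies either of them, and the two values
   cancel. *)
Lemma kills_form_spread J psi : kills_form J psi -> kills_form J (spread J psi).
Proof.
move=> psiJ; apply: kills_formX => I m; rewrite mulr_suml raddf_sum /=.
under eq_bigr do rewrite ev_mulX !ev_slice_spread.
have [I1|I1] := eqVneq (~: I) set0.
  rewrite -[RHS](psiJ 'X_[m]) mulr_suml raddf_sum; apply: eq_bigr => j jJ.
  have -> : j \in I by rewrite -(setCK I) I1 setC0 inE.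
  by rewrite setCD I1 set0U in_singles jJ.
pose e := ev psi 'X_[m].
rewrite (eq_bigr (fun j => if (j \in ~: I) && (~: I :\ j \in singles J) then e else 0)); last first.
  move=> j jJ; rewrite inE; case: ifP => jI /=; last first.
    by rewrite setCU setIC -setDE.
  case: ifP => // /card_singles/eqP/cards1P [z E].
  have [y yI] := set0Pn _ I1.
  have : j \in [set z] by rewrite -E !inE eqxx.
  have : y \in [set z] by move: yI; rewrite -E !inE => /negPf ->; rewrite andbF.
  rewrite !in_set1 => /eqP yz /eqP xz; move: yI.
  by rewrite yz -xz inE jI.
have [/eqP/cards2P [x [y [xy ->]]]|c2] := eqVneq #|~: I| 2; last first.
  apply: big1 => j _; case: ifP => // /andP[jI /card_singles c1].
  by move: c2; rewrite (cardsD1 j) jI c1.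
rewrite big_mkcond /= (bigD1 x) //= (bigD1 y) //=; last by rewrite eq_sym.
rewrite big1 ?addr0 => [|j /andP[jx jy]]; last first.
  by rewrite !inE (negPf jx) (negPf jy) /= if_same.
rewrite !inE !eqxx orbT /=.
have -> : [set x; y] :\ x = [set y].
  by apply/setP => j; rewrite !inE; case: eqVneq => // ->; rewrite (negPf xy).
have -> : [set x; y] :\ y = [set x].
  by apply/setP => j; rewrite !inE; case: (eqVneq j y) => [->|]; rewrite ?orbF // eq_sym (negPf xy).
rewrite !in_singles; case: (x \in J); case: (y \in J) => //; rewrite ?addr0 //.
exact: addF2.
Qed.

End Lift.

(** * Degrees of iterated spreads *)
Section Descent.
Variable k : nat.
Implicit Types (f g v : P k) (m : 'X_{1..k}) (I J C S : {set 'I_k}).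
Implicit Types phi psi : functional k.
Implicit Types (i j l : 'I_k) (w u r : seq 'I_k) (F : 'I_k -> functional k).

(** The degree reached from n by t spreads. *)
Fixpoint tower n t : nat := if t is t'.+1 then k.-1 + (tower n t').*2 else n.

Arguments tower : simpl never.

Lemma towerS n t : tower n t.+1 = (k.-1 + (tower n t).*2)%N.
Proof. by []. Qed.

Lemma popcount_tower n t : popcount (tower n t + k.-1) = popcount (n + k.-1).
Proof.
elim: t => // t <-; rewrite -[in RHS]popcount_double; congr popcount.
by rewrite towerS doubleD -[k.-1.*2]addnn; lia.
Qed.

(** * The Milnor primitive Q_1 *)

(** The commutator of Sq^2 and Sq^1 is a derivation, which makes its value on a
   product of a squarefree monomial and a square computable. *)
Definition milnorQ1 f : P k := Sq 2 (Sq 1 f) + Sq 1 (Sq 2 f).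

Lemma leibniz_commutator (s1 s2 : P k -> P k) :
  {morph s1 : x y / x + y} -> {morph s2 : x y / x + y} ->
  (forall x y, s1 (x * y) = x * s1 y + s1 x * y) ->
  (forall x y, s2 (x * y) = x * s2 y + s1 x * s1 y + s2 x * y) ->
  forall f g, s2 (s1 (f * g)) + s1 (s2 (f * g)) =
    (s2 (s1 f) + s1 (s2 f)) * g + f * (s2 (s1 g) + s1 (s2 g)).
Proof.
move=> s1D s2D s1M s2M f g; rewrite s1M s2M !s1D s2D !s1M !s2M.
pose e := s1 f * s2 g + s2 f * s1 g + s1 f * s1 (s1 g) + s1 (s1 f) * s1 g.
by rewrite -[RHS]addr0 -(addff e) /e; ring.
Qed.

Lemma milnorQ1M f g : milnorQ1 (f * g) = milnorQ1 f * g + f * milnorQ1 g.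
Proof.
have E1 (x y : P k) : Sq 1 (x * y) = x * Sq 1 y + Sq 1 x * y.
  by rewrite Sq_cartan !big_ord_recl big_ord0 /= !Sq_0 addr0.
have E2 (x y : P k) : Sq 2 (x * y) = x * Sq 2 y + Sq 1 x * Sq 1 y + Sq 2 x * y.
  by rewrite Sq_cartan !big_ord_recl big_ord0 /= !Sq_0 addr0 addrA.
exact: (leibniz_commutator (raddfD _) (raddfD _) E1 E2).
Qed.

Lemma milnorQ1_sqr f : milnorQ1 (f ^+ 2) = 0.
Proof. by rewrite expr2 milnorQ1M mulrC addff. Qed.

Lemma milnorQ1X j : milnorQ1 'X_j = 'X_j ^+ 4.
Proof.
rewrite /milnorQ1 !Sq_var /= raddf0 addr0.
have E := Sq_total_linear _ (Sq_totalX j).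
by rewrite expr2 E !Sq_var mulr0 add0r -exprD.
Qed.

Lemma milnorQ1_sqfree I : milnorQ1 'X_[sqfree I] =
  \sum_(i in I) 'X_[sqfree (I :\ i)] * 'X_i ^+ 4.
Proof.
have [n] := ubnP #|I|; elim: n I => // n IH I lt_n.
have [->|[i iI]] := set_0Vmem I.
  rewrite big_set0 sqfree_set0 mpolyX0 /milnorQ1.
  by rewrite !Sq_1 ?raddf0 ?addr0.
have {}lt_n : (#|I :\ i| < n)%N by move: lt_n; rewrite (cardsD1 i) iI.
have iN : i \notin I :\ i by rewrite in_setD1 eqxx.
rewrite (bigD1 i) //= -{1}(setD1K iI) sqfree_setU1 // mpolyXD milnorQ1M.
rewrite milnorQ1X addrC IH //; congr (_ + _).
rewrite mulr_suml [RHS](eq_bigl (mem (I :\ i))) => [|j]; last first.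
  by rewrite /= in_setD1 andbC.
apply: eq_bigr => j; rewrite in_setD1 => /andP[ji jI].
have -> : I :\ j = i |: (I :\ i :\ j).
  apply/setP => x; rewrite !inE; case: (eqVneq x i) => [->|_] //=.
  by rewrite eq_sym ji iI.
rewrite sqfree_setU1 ?mpolyXD ?in_setD1 ?eqxx ?andbF //.
exact: mulrAC.
Qed.

(** * Strands *)
Definition strand phi j : functional k := slice phi (~: [set j]).
(** The relation that Sq^1(x_1...x_k v^2) imposes on the strands of a
   functional. *)
Definition balanced F := forall v, \sum_j ev (F j) ('X_j * v) = 0.

(** Balance at x_I v^2 with I missing i and l.  For other j, x_j x_I v^2 has
   only k - 3 odd exponents, where F j vanishes; the terms at i and l remain. *)
Lemma strand_balanced_sym n F i l :
  (forall j, QP_dual n (F j)) -> (exists d, n = k.-1 + d.*2)%N ->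
  (k.-1 <= popcount (n + k.-1))%N ->
  balanced F -> i != l -> strand (F i) l = strand (F l) i.
Proof.
move=> Fn [d nd] pc bF il; apply: funext => m.
have := bF ('X_[sqfree (~: [set i; l])] * 'X_[m] ^+ 2).
under eq_bigr do rewrite ev_mulX.
rewrite (bigD1 i) //= (bigD1 l) //=; last by rewrite eq_sym.
rewrite !inE !eqxx orbT /= big1 => [|j /andP[ji jl]]; last first.
  rewrite !inE (negPf ji) (negPf jl) /=.
  rewrite (_ : ev _ _ = ev (fun=> 0) ('X_j * 'X_[m])); first exact: ev_zero.
  apply: ev_ext => x; apply: dual_low nd pc (Fn j) _.
  have := cardsC [set i; l]; rewrite cards2 il card_ord.
  rewrite (cardsD1 j (~: _)) !inE (negPf ji) (negPf jl) /=.
  by case: #|_| => [|c] <-.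
have -> : i |: ~: [set i; l] = ~: [set l].
  by apply/setP => x; rewrite !inE; case: (eqVneq x i) => [->|].
have -> : l |: ~: [set i; l] = ~: [set i].
  by apply/setP => x; rewrite !inE orbC; case: (eqVneq x l) => [->|_]; rewrite ?orbT ?orbF //= eq_sym il.
by rewrite addr0 !evX => /eqP; rewrite addF2_eq0 => /eqP.
Qed.

(** Balance at x_1...x_k v^2, because x_j x_1...x_k v^2 = X_j (x_j v)^2. *)
Lemma balanced_diag F : balanced F -> balanced (fun j => strand (F j) j).
Proof.
move=> bF v; rewrite -[RHS](bF ('X_[sqfree setT] * v ^+ 2)).
by apply: eq_bigr => j _; rewrite ev_mulX inE /strand setTD.
Qed.

Lemma card_setC1 (j : 'I_k) : #|~: [set j]| = k.-1.
Proof. by have := cardsC [set j]; rewrite cards1 card_ord; lia. Qed.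

Variable n : nat.
Hypothesis pc : (k.-1 <= popcount (n + k.-1))%N.

Lemma slice_low t phi I m : QP_dual (tower n t.+1) phi -> (#|I| < k.-1)%N ->
  slice phi I m = 0.
Proof. by apply: (@dual_low k _ (tower n t)); rewrite ?popcount_tower. Qed.

Lemma ev_slice_low t phi I v : QP_dual (tower n t.+1) phi -> (#|I| < k.-1)%N ->
  ev (slice phi I) v = 0.
Proof.
by move=> D lt; rewrite -[RHS](ev_zero v); apply: ev_ext => m; apply: slice_low D lt.
Qed.

(** Up to terms with fewer odd exponents, Sq^(2a)(X_j v^2) = X_j (Sq^a v)^2. *)
Lemma dual_strand t phi j : QP_dual (tower n t.+1) phi -> QP_dual (tower n t) (strand phi j).
Proof.
move=> D; have [phi_n phiS] := D; split=> [m mn|a f a0].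
  apply: phi_n; rewrite mdegD mdegMn mdeg_sqfree card_setC1 towerS.
  by move: mn; lia.
move: f; apply: (ev_X_eq0 (raddfD (@Sq k a))) => I m.
move: ('X_[_] * _) => v.
rewrite -[RHS](phiS a.*2 ('X_[sqfree (~: [set j])] * v ^+ 2)) ?double_gt0 // ev_Sq.
rewrite (bigD1 set0) /=; last by rewrite cards0 sub0set subn0 odd_double.
rewrite big1 => [|C /andP[/and3P[CI _ _] C0]]; last first.
  apply: ev_slice_low D _; rewrite cardsD (setIidPr CI) card_setC1.
  have := subset_leq_card CI; rewrite card_setC1.
  by move: C0; rewrite -card_gt0; lia.
by rewrite addr0 setD0 cards0 subn0 doubleK sqfree_set0 mpolyX0 mul1r.
Qed.

Lemma balanced_strand t phi : QP_dual (tower n t.+1) phi -> balanced (strand phi).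
Proof.
move=> D v; rewrite -[RHS](D.2 1%N ('X_[sqfree setT] * v ^+ 2)) // ev_Sq.
rewrite (eq_bigl (mem (singles setT))) => [|C]; last first.
  rewrite subsetT /=; apply/andP/idP => [[C1 C2]|/card_singles -> //].
  have /eqP/cards1P [j ->] : #|C| = 1%N by move: C1 C2; case: #|C| => [|[]].
  by rewrite in_singles inE.
rewrite sum_singles [RHS]big_mkcond; apply: eq_bigr => j _.
by rewrite inE cards1 subnn Sq_0 sqfree_set1 setTD.
Qed.

(** The relation imposed by Q_1(x_1...x_k v^2). *)
Lemma balanced2_strand t phi v : QP_dual (tower n t.+1) phi ->
  \sum_j ev (strand phi j) ('X_j ^+ 2 * v) = 0.
Proof.
move=> D; transitivity (ev phi (milnorQ1 ('X_[sqfree setT] * v ^+ 2))); last first.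
  by rewrite /milnorQ1 raddfD /= !D.2 // addr0.
rewrite milnorQ1M milnorQ1_sqr mulr0 addr0 milnorQ1_sqfree mulr_suml raddf_sum.
rewrite [RHS]big_mkcond /=; apply: eq_bigr => j _.
by rewrite inE setTD ev_slice exprMn -exprM -mulrA.
Qed.

(** * Strands along words *)

Definition strands phi w := foldl strand phi w.

Lemma dual_strands t phi w :
  QP_dual (tower n (size w + t)) phi -> QP_dual (tower n t) (strands phi w).
Proof. by elim: w phi => //= i w IH phi D; apply/IH/dual_strand. Qed.

Lemma strand_swap t phi i l : QP_dual (tower n t.+2) phi ->
  strand (strand phi i) l = strand (strand phi l) i.
Proof.
move=> D; have [->//|il] := eqVneq i l.
apply: (@strand_balanced_sym (tower n t.+1)) => //.
- by move=> j; apply: dual_strand.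
- by exists (tower n t).
- by rewrite popcount_tower.
- exact: balanced_strand D.
Qed.

(** With strand_swap, this turns the subword i i l into i l l: the number of
   times a letter occurs does not matter. *)
Lemma strand_absorb t phi i l : QP_dual (tower n t.+3) phi ->
  strand (strand (strand phi i) i) l = strand (strand (strand phi l) l) i.
Proof.
move=> D; have [->//|il] := eqVneq i l.
apply: (@strand_balanced_sym (tower n t.+1) (fun j => strand (strand phi j) j)) => //.
- by move=> j; do 2!apply: dual_strand.
- by exists (tower n t).
- by rewrite popcount_tower.
- exact/balanced_diag/balanced_strand/D.
Qed.

Lemma strands_pull phi u (x : 'I_k) r : QP_dual (tower n (size u + (size r).+1)) phi ->
  strands phi (u ++ x :: r) = strands phi (x :: u ++ r).
Proof.
elim: u phi => //= y u IH phi D; rewrite IH; last exact: dual_strand.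
by rewrite /= (@strand_swap (size u + size r)) //; move: D; rewrite /= addSn addnS.
Qed.

Lemma strands_perm phi w u : QP_dual (tower n (size w)) phi -> perm_eq w u ->
  strands phi w = strands phi u.
Proof.
elim: w phi u => [|x w IH] phi u D; first by rewrite perm_sym => /perm_nilP ->.
move=> pwu; have : x \in u by rewrite -(perm_mem pwu) mem_head.
move/splitPr => E; case: E pwu => u1 u2.
rewrite perm_sym -cat1s perm_catCA cat1s perm_cons perm_sym => pw.
have sw := perm_size pw; rewrite size_cat in sw.
rewrite strands_pull /= ?addnS -?sw //; apply: IH => //.
exact: dual_strand.
Qed.

Lemma strands_absorb phi u r (x : 'I_k) : QP_dual (tower n (size u + size r)) phi ->
  x \in u -> {subset r <= u} -> strands phi (u ++ r) = strands phi (u ++ nseq (size r) x).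
Proof.
elim: r phi => [//|y r IH] phi D xu ru.
have D' : QP_dual (tower n (size u + size r)) (strand phi y).
  by apply: dual_strand; rewrite -addnS.
rewrite strands_pull //= IH //; last by move=> z zr; apply: ru; rewrite inE zr orbT.
rewrite -/(strands phi (y :: u ++ nseq (size r) x)).
rewrite strands_pull ?size_nseq // /=.
have [->//|yx] := eqVneq y x.
have yu : y \in u by apply: ru; rewrite mem_head.
have pu : perm_eq (u ++ nseq (size r) x) (x :: y :: rem y (rem x u) ++ nseq (size r) x).
  rewrite -!cat_cons perm_cat2r; apply: perm_trans (perm_to_rem xu) _.
  rewrite perm_cons perm_to_rem //.
  by have := perm_mem (perm_to_rem xu) y; rewrite yu inE (negPf yx).
have sz := perm_size pu; rewrite /= !size_cat /= !size_nseq in sz.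
have Dx : QP_dual (tower n (size (rem y (rem x u)) + size r).+3) phi.
  have -> : ((size (rem y (rem x u)) + size r).+3 = size u + (size r).+1)%N.
    by rewrite addnS sz.
  exact: D.
have Dq : QP_dual (tower n (size (rem y (rem x u)) + size r))
    (strand (strand (strand phi x) y) y).
  by do 3!apply: dual_strand.
transitivity (strands phi (y :: x :: y :: rem y (rem x u) ++ nseq (size r) x)).
  rewrite -[LHS]/(strands phi (y :: u ++ nseq (size r) x)).
  apply: strands_perm; last by rewrite perm_cons.
  by move: D; rewrite /= size_cat size_nseq addnS.
transitivity (strands phi (x :: x :: y :: rem y (rem x u) ++ nseq (size r) x)); last first.
  rewrite -[RHS]/(strands phi (x :: u ++ nseq (size r) x)).
  apply: strands_perm; last by rewrite perm_cons perm_sym.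
  by rewrite /= size_cat size_nseq.
rewrite /= (@strand_absorb (size (rem y (rem x u)) + size r) phi x y) //.
rewrite (@strand_swap (size (rem y (rem x u)) + size r) (strand phi y)) //.
exact: dual_strand.
Qed.

(** Both words reduce to the list of their distinct letters followed by copies
   of a single letter. *)
Lemma strands_support phi w u : QP_dual (tower n (size w)) phi ->
  size w = size u -> w =i u -> strands phi w = strands phi u.
Proof.
have canon z : QP_dual (tower n (size z)) phi -> forall x, x \in z ->
    strands phi z = strands phi (undup z ++ nseq (size z - size (undup z)) x).
  move=> D x xz; have [r pr] : exists r, perm_eq z (undup z ++ r).
    elim: z {D xz} => [|y z [r IH]]; first by exists [::].
    rewrite /=; case: ifP => _; last by exists r; rewrite /= perm_cons.
    by exists (y :: r); rewrite perm_sym -cat1s perm_catCA cat1s perm_cons perm_sym.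
  have sr := perm_size pr; rewrite size_cat in sr.
  rewrite (strands_perm D pr) sr addKn; apply: strands_absorb.
  - by rewrite -sr.
  - by rewrite mem_undup.
  - by move=> y yr; rewrite mem_undup (perm_mem pr) mem_cat yr orbT.
case: w canon => [|x w] canon D swu wu; first by case: u swu wu.
rewrite (canon _ D x) ?mem_head // (canon u _ x) -?wu ?mem_head // -?swu //.
have pu : perm_eq (undup (x :: w)) (undup u).
  by apply: uniq_perm; rewrite ?undup_uniq // => y; rewrite !mem_undup wu.
rewrite (perm_size pu); apply: strands_perm; last by rewrite perm_cat2r.
move: D; rewrite size_cat size_nseq -(perm_size pu) subnKC // size_undup.
by [].
Qed.

End Descent.

(** * Moebius inversion over subsets modulo 2 *)
Section SetSums.
Variable k : nat.
Implicit Types (i j l x : 'I_k) (I J C S T : {set 'I_k}).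
Implicit Types G : {set 'I_k} -> 'F_2.

Lemma setD1_id j S : j \notin S -> S :\ j = S.
Proof. by move=> jS; apply/setDidPl; rewrite disjoint_sym disjoints1. Qed.

Lemma sub_setU1_setD1 j S T : j \notin S -> (S \subset j |: T) = (S \subset T :\ j).
Proof.
move=> jS; apply/subsetP/subsetP => H x xS; have := H x xS; rewrite !inE.
  by case: (eqVneq x j) => // xj; rewrite -xj xS in jS.
by case/andP=> _ ->; rewrite orbT.
Qed.

Lemma setU1_setD1_sub j S T : j \in T -> (j |: S \subset T) = (S :\ j \subset T).
Proof.
move=> jT; rewrite subUset sub1set jT; apply/subsetP/subsetP => H x.
  by rewrite in_setD1 => /andP[_]; apply: H.
by case: (eqVneq x j) => [->|xj xS] //; apply: H; rewrite in_setD1 xj.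
Qed.

Lemma setU1_setD1 j S : j |: S :\ j = j |: S.
Proof. by apply/setP => x; rewrite !inE; case: eqVneq. Qed.

(** The sets with and without j pair off. *)
Lemma sum_sets_cancel j G : (forall S, G (j |: S) = G (S :\ j)) -> \sum_S G S = 0.
Proof.
move=> GE; rewrite (bigID (fun S => j \in S)) /=.
rewrite (reindex_onto (fun S => j |: S) (fun S => S :\ j)) /=; last first.
  by move=> S jS; rewrite setD1K.
rewrite (eq_bigl (fun S => j \notin S)) => [|S]; last first.
  rewrite setU11 /=; apply/eqP/idP => [<-|jS]; first by rewrite in_setD1 eqxx.
  by rewrite setU1K.
rewrite -big_split /= big1 // => S jS.
by rewrite GE (setD1_id jS) addF2.
Qed.

Lemma sum_interval S T (c : 'F_2) :
  \sum_(J : {set 'I_k} | (S \subset J) && (J \subset T)) c = if S == T then c else 0.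
Proof.
case: eqVneq => [->|ST].
  by rewrite (big_pred1 T) // => J; rewrite -eqEsubset eq_sym.
have [sST|/negPf nST] := boolP (S \subset T); last first.
  by apply: big_pred0 => J; apply/andP => -[SJ /(subset_trans SJ)]; rewrite nST.
have /subsetPn [j jT jS] : ~~ (T \subset S).
  by apply: contra ST => TS; rewrite eqEsubset sST.
rewrite big_mkcond; apply: (sum_sets_cancel (j := j)) => J.
by rewrite sub_setU1_setD1 // setU1_setD1_sub.
Qed.

Variable F : {set 'I_k} -> functional k.
Implicit Types v : P k.

Definition upsum J : functional k := fun m => \sum_(S : {set 'I_k} | J \subset S) F S m.

(** For j in J the union with j changes nothing; for j outside J the terms at S
   with and without j coincide and cancel. *)
Lemma upsum_balance J v :
  \sum_(S : {set 'I_k} | J \subset S) \sum_j ev (F (j |: S)) ('X_j * v) =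
  ev (upsum J) (linform J * v).
Proof.
rewrite exchange_big /= mulr_suml raddf_sum /= [RHS]big_mkcond; apply: eq_bigr => j _.
rewrite ev_sum; case: ifP => [jJ|/negbT jJ].
  apply: eq_bigr => S JS; congr (ev (F _) _).
  by apply/setUidPr; rewrite sub1set (subsetP JS).
rewrite big_mkcond; apply: (sum_sets_cancel (j := j)) => S.
by rewrite setUA setUid setU1_setD1 sub_setU1_setD1.
Qed.

Lemma upsumK S m : \sum_(J : {set 'I_k} | S \subset J) upsum J m = F S m.
Proof.
rewrite /upsum (exchange_big_dep predT) //=.
under eq_bigr do rewrite sum_interval.
by rewrite -big_mkcond (big_pred1 S) // => T; rewrite eq_sym.
Qed.

End SetSums.

Lemma F2_exchange (a b d e : 'F_2) : a + b = d + e -> e + b = d + a.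
Proof.
move=> H; apply: (addrI a).
by rewrite addrCA H addrCA addF2 addr0 addrCA addF2 addr0.
Qed.

(** * Strands of iterated spreads *)
Section Decomposition.
Variables k n s : nat.
Implicit Types (f g v : P k) (m : 'X_{1..k}) (I J C S T : {set 'I_k}).
Implicit Types phi psi : functional k.
Implicit Types (i j l : 'I_k) (w r : seq 'I_k).
Hypothesis pc : (k.-1 <= popcount (n + k.-1))%N.
Hypothesis k_gt0 : (0 < k)%N.

Definition place w m : 'X_{1..k} :=
  foldr (fun j x => sqfree (~: [set j]) + x *+ 2)%MM m w.

Lemma strandsE phi w m : strands phi w m = phi (place w m).
Proof. by elim: w phi => //= j w IH phi; rewrite IH. Qed.

Lemma strand_spread J psi j : strand (spread J psi) j = if j \in J then psi else fun=> 0.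
Proof.
apply: funext => m; rewrite /strand slice_spread setCK in_singles.
by case: ifP.
Qed.

Lemma strands_iter_spread t J psi w : size w = t ->
  strands (iter t (spread J) psi) w =
  if [set x in w] \subset J then psi else fun=> 0.
Proof.
move=> <-; elim: w => [|j w IH]; first by rewrite (_ : [set x in [::]] = set0) ?sub0set //; apply/setP => x; rewrite !inE.
rewrite /= strand_spread set_cons subUset sub1set; case: ifP => //= _.
by apply: funext => m; rewrite strandsE.
Qed.

Lemma dual_iter_spread t J psi : QP_dual n psi -> kills_form J psi ->
  QP_dual (tower k n t) (iter t (spread J) psi) /\ kills_form J (iter t (spread J) psi).
Proof.
move=> D kJ; elim: t => //= t [IH1 IH2]; split; last exact: kills_form_spread.
exact: dual_spread.
Qed.

Lemma strands_eq0 t phi : QP_dual (tower k n t) phi ->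
  (forall w, size w = t -> strands phi w = fun=> 0) -> phi = fun=> 0.
Proof.
elim: t phi => [|t IH] phi D W0; first exact: (W0 [::]).
apply: funext => x; apply: (@slice_ext k phi (fun=> 0)) => I m.
rewrite [RHS]/slice; have [ltI|geI] := ltnP #|I| k.-1; first exact: slice_low D ltI.
have leI : (#|I| <= k)%N by rewrite -[X in (_ <= X)%N](card_ord k) max_card.
have [IT|IT] := eqVneq #|I| k.
  apply: D.1; rewrite mdegD mdegMn mdeg_sqfree IT towerS.
  by have := k_gt0; lia.
have /eqP/cards1P [j Ij] : #|~: I| = 1%N.
  by have := cardsC I; rewrite card_ord; move: IT geI leI k_gt0; clear; lia.
rewrite -(setCK I) Ij -[slice _ _ _]/(strand phi j m).
rewrite (IH (strand phi j)) //; first exact: dual_strand.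
by move=> w sw; apply: (W0 (j :: w)); rewrite /= sw.
Qed.

(** * Strands indexed by supports *)

Variable phi0 : functional k.
Hypothesis D0 : QP_dual (tower k n s) phi0.
Hypothesis s_gt0 : (0 < s)%N.

Definition word t S : seq 'I_k :=
  if [pick x in S] is Some x then enum S ++ nseq (t - #|S|) x else [::].

Lemma wordP t S : S != set0 -> (#|S| <= t)%N ->
  size (word t S) = t /\ [set x in word t S] = S.
Proof.
rewrite /word => S0 St; case: pickP => [x xS|H]; last first.
  by case/set0Pn: S0 => x; rewrite H.
rewrite size_cat size_nseq -cardE subnKC //; split=> //.
apply/setP => y; rewrite inE mem_cat mem_enum mem_nseq.
by apply/orP/idP => [[//|/andP[_ /eqP ->]]|]; last left.
Qed.

Definition by_support S : functional k :=
  if S == set0 then fun=> 0 else strands phi0 (word s S).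

Lemma strands_by_support w : size w = s ->
  strands phi0 w = by_support [set x in w].
Proof.
move=> sw; have W0 : [set x in w] != set0.
  case: w sw => [s0|x w _]; first by have := s_gt0; rewrite -s0.
  by apply/set0Pn; exists x; rewrite inE mem_head.
have Ws : (#|[set x in w]| <= s)%N by rewrite -sw cardsE card_size.
have [sz E] := wordP W0 Ws; rewrite /by_support (negPf W0).
apply: (strands_support pc); rewrite ?sw ?sz // => x.
by move/setP/(_ x): E; rewrite !inE.
Qed.

Lemma dual_by_support S : (#|S| <= s)%N -> QP_dual n (by_support S).
Proof.
rewrite /by_support => Ss; case: eqVneq => [_|S0]; first exact: dual0.
have [sz _] := wordP S0 Ss; apply: (dual_strands (t := 0) pc).
by rewrite addn0 sz.
Qed.

Lemma balanced_word w : (size w).+1 = s ->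
  balanced (fun j => by_support (j |: [set x in w])).
Proof.
move=> sw v; have Dw : QP_dual (tower k n 1) (strands phi0 w).
  by apply: dual_strands => //; rewrite addn1 sw.
rewrite -[RHS](balanced_strand Dw v).
apply: eq_bigr => j _; congr (ev _ _).
rewrite -[strand _ j]/(strands (strands phi0 w) [:: j]) /strands -foldl_cat -/(strands _ _).
rewrite strands_by_support ?size_cat ?addn1 //; congr by_support.
by apply/setP => x; rewrite !inE mem_cat inE orbC.
Qed.

Lemma balanced2_word w v : (size w).+1 = s ->
  \sum_j ev (by_support (j |: [set x in w])) ('X_j ^+ 2 * v) = 0.
Proof.
move=> sw; have Dw : QP_dual (tower k n 1) (strands phi0 w).
  by apply: dual_strands => //; rewrite addn1 sw.
rewrite -[RHS](balanced2_strand v Dw).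
apply: eq_bigr => j _; congr (ev _ _).
rewrite -[strand _ j]/(strands (strands phi0 w) [:: j]) /strands -foldl_cat -/(strands _ _).
rewrite strands_by_support ?size_cat ?addn1 //; congr by_support.
by apply/setP => x; rewrite !inE mem_cat inE orbC.
Qed.

(** For nonempty S this is balance of the strands along a word of length s - 1
   with support S.  For empty S the words are powers of one letter, and
   balanced_diag raises the power. *)
Lemma balanced_by_support S : (#|S| < s)%N ->
  balanced (fun j => by_support (j |: S)).
Proof.
move=> Ss; have [S0|S0] := eqVneq S set0; last first.
  have S_le : (#|S| <= s.-1)%N by rewrite -ltnS prednK.
  have [sz <-] := wordP S0 S_le.
  by apply: balanced_word; rewrite sz prednK.
have B t : (t < s)%N -> balanced (fun j => strands phi0 (nseq t.+1 j)).
  elim: t => [|t IH] ts.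
    by apply: (balanced_strand (n := n) (t := s.-1)); rewrite prednK.
  move=> v; rewrite -[RHS](balanced_diag (IH (ltnW ts)) v).
  apply: eq_bigr => j _; congr (ev _ _); rewrite -[strand _ j]/(strands _ [:: j]).
  rewrite /strands -foldl_cat; congr foldl.
  by rewrite -[t.+2]addn1 nseqD.
have lt_s : (s.-1 < s)%N by rewrite prednK.
move=> v; rewrite -[RHS](B _ lt_s v) prednK //; apply: eq_bigr => j _.
rewrite strands_by_support ?size_nseq // S0; congr (ev (by_support _) _).
by apply/setP => x; rewrite !inE orbF mem_nseq s_gt0.
Qed.

(** When s = k - 1 the functional of the full set, called top, is prescribed on
   the multiples of x_i by balance at the complement of i, whose functional is
   called X i: top(x_i v) = X i (g_i v), with g_i the sum of the other
   variables.  The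
   prescriptions for i and l agree on x_i x_l v: this follows from balance at
   the complement S of {i, l}, and from its analogue with squared variables
   that comes from Q_1, as the square of the sum of the variables in S is the
   sum of their squares. *)
Lemma complete_family : (k.-1 <= s)%N -> (k <= s)%N || (0 < n)%N ->
  exists F : {set 'I_k} -> functional k,
    [/\ forall S, S != setT \/ (k <= s)%N -> F S = by_support S,
        forall S, QP_dual n (F S)
      & forall S, balanced (fun j => F (j |: S))].
Proof.
move=> le_s dich.
have card_proper S : S != setT -> (#|S| < k)%N.
  by rewrite -properT => /proper_card; rewrite cardsT card_ord.
(* Once the identities hold below the full set, summing them all gives the one
   for the full set. *)
have fullP F : (forall S, S != setT -> balanced (fun j => F (j |: S))) ->
    forall S, balanced (fun j => F (j |: S)).
  move=> FB S; have [->|] := eqVneq S setT; last exact: FB.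
  move=> v; have := upsum_balance F set0 v.
  rewrite /linform big_set0 mul0r raddf0 (bigD1 setT) ?subsetT //=.
  by rewrite [X in _ + X]big1 ?addr0 // => T /andP[_ /FB].
have [le_ks|lt_sk] := leqP k s.
  exists by_support; split=> // [S|].
    apply: dual_by_support; apply: leq_trans le_ks.
    by rewrite -[X in (_ <= X)%N](card_ord k) max_card.
  apply: fullP => S /card_proper lt_S; apply: balanced_by_support.
  exact: leq_trans lt_S le_ks.
have sE : s = k.-1 by lia.
have n_gt0 : (0 < n)%N by move: dich; rewrite leqNgt lt_sk.
pose X i := by_support (~: [set i]).
have DX i : QP_dual n (X i) by apply: dual_by_support; rewrite card_setC1 sE.
pose g i := linform (~: [set i]).
have compat i l v : ev (X i) (g i * ('X_l * v)) = ev (X l) (g l * ('X_i * v)).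
  have [->//|il] := eqVneq i l.
  pose S := ~: [set i; l]; pose h := linform S.
  have cardS : (#|S|.+1 = s)%N.
    have := cardsC [set i; l]; rewrite cards2 il card_ord -/S sE.
    by move: #|S|; clear; lia.
  have iS : i |: S = ~: [set l].
    by apply/setP => x; rewrite !inE; case: (eqVneq x i) => [->|].
  have lS : l |: S = ~: [set i].
    by apply/setP => x; rewrite !inE orbC; case: (eqVneq x l) => [->|_]; rewrite ?orbT ?orbF //= eq_sym il.
  have gi : g i = 'X_l + h by rewrite /g -lS /linform big_setU1 // !inE eqxx orbT.
  have gl : g l = 'X_i + h by rewrite /g -iS /linform big_setU1 // !inE eqxx.
  have split3 (H : 'I_k -> 'F_2) : \sum_j H j = H i + H l + \sum_(j in S) H j.
    rewrite (bigD1 i) //= (bigD1 l) //=; last by rewrite eq_sym.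
    rewrite addrA; congr (_ + _); apply: eq_bigl => j.
    by rewrite !inE negb_or.
  have SS (j : 'I_k) : j \in S -> j |: S = S by move=> jS; apply/setUidPr; rewrite sub1set.
  have R1 u : ev (X l) ('X_i * u) + ev (X i) ('X_l * u) + ev (by_support S) (h * u) = 0.
    rewrite -[RHS](balanced_by_support (S := S) _ u); last by rewrite -cardS.
    rewrite split3 iS lS; congr (_ + _).
    rewrite mulr_suml raddf_sum; apply: eq_bigr => j jS.
    by rewrite SS.
  have R2 : ev (X l) ('X_i ^+ 2 * v) + ev (X i) ('X_l ^+ 2 * v) + ev (by_support S) (h ^+ 2 * v) = 0.
    have [w szw Ew] : exists2 w, (size w).+1 = s & [set x in w] = S.
      exists (enum S); first by rewrite -cardE.
      by apply/setP => x; rewrite inE mem_enum.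
    rewrite -[RHS](balanced2_word v szw) Ew split3 iS lS; congr (_ + _).
    rewrite /h /linform (sqr_sum2 (@pcharP k)) mulr_suml raddf_sum; apply: eq_bigr => j jS.
    by rewrite SS.
  have := R1 (h * v); rewrite -[RHS]addr0 -{1}R2 mulrA -expr2.
  rewrite addr0 => /addIr E.
  rewrite gi gl (_ : _ * ('X_l * v) = 'X_l ^+ 2 * v + 'X_l * (h * v)); last by ring.
  rewrite (_ : _ * ('X_i * v) = 'X_i ^+ 2 * v + 'X_i * (h * v)); last by ring.
  by rewrite !raddfD; apply: F2_exchange.
pose top : functional k := fun m =>
  if [pick i | m i != 0%N] is Some i then ev (X i) (g i * 'X_[m - U_(i)]) else 0.
have topE l v : ev top ('X_l * v) = ev (X l) (g l * v).
  elim/F2_mpoly_ind: v => [|m f IH]; first by rewrite !mulr0 !raddf0.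
  rewrite !mulrDr !raddfD /= IH; congr (_ + _).
  rewrite -mpolyXD evX /top; case: pickP => [i|/(_ l)]; last first.
    by rewrite mnmDE mnm1E eqxx.
  have [->|il] := eqVneq i l; first by rewrite addmC addmK.
  rewrite mnmDE mnm1E [l == i]eq_sym (negPf il) add0n => mi.
  have Em : (m = U_(i) + (m - U_(i)))%MM by rewrite addmC submK // lep1mP.
  rewrite {2}Em mpolyXD -compat; congr (ev _ (_ * _)).
  by rewrite -mpolyXD {1}Em addmA [(U_(l) + _)%MM]addmC -addmA addmC addmK.
pose F S := if S == setT then top else by_support S.
have FB : forall S, balanced (fun j => F (j |: S)).
  apply: fullP => S ST v; have leS : (#|S| <= k.-1)%N.
    by rewrite -ltnS prednK // card_proper.
  move: leS; rewrite leq_eqVlt => /orP[/eqP cS|lt_S]; last first.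
    rewrite -[RHS](balanced_by_support (S := S) _ v) ?sE //.
    apply: eq_bigr => j _; rewrite /F ifN //.
    apply: contraTneq lt_S => jS; rewrite -leqNgt -ltnS prednK //.
    have cU : k = ((j \notin S) + #|S|)%N by rewrite -cardsU1 jS cardsT card_ord.
    by rewrite [X in (X <= _)%N]cU -add1n leq_add2r leq_b1.
  have /eqP/cards1P [i Si] : #|~: S| = 1%N.
    by have := cardsC S; rewrite card_ord cS; move: k_gt0; lia.
  have {Si ST cS} -> : S = ~: [set i] by rewrite -Si setCK.
  rewrite (bigD1 i) //= setUCr {1}/F eqxx topE.
  rewrite (_ : \sum_(j | j != i) _ = ev (X i) (g i * v)); first exact: addF2.
  rewrite mulr_suml raddf_sum /=; apply: eq_big => j; first by rewrite !inE.
  move=> ji; have -> : j |: ~: [set i] = ~: [set i].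
    by apply/setUidPr; rewrite sub1set !inE.
  by rewrite /F ifN //; apply/eqP => /setP/(_ i); rewrite !inE eqxx.
have topT v : ev top (linform setT * v) = 0.
  rewrite -[RHS](FB setT v) mulr_suml raddf_sum big_mkcond.
  by apply: eq_bigr => j _; rewrite setUT /F eqxx inE.
have Dtop : QP_dual n top.
  split=> [m mn|a f a0].
    rewrite /top; case: pickP => // i mi; rewrite mulr_suml raddf_sum /=.
    apply: big1 => j _; rewrite -mpolyXD evX; apply: (DX i).1.
    by rewrite mdegD mdeg1 -(@mdeg1 k i) -mdegD addmC submK // lep1mP.
  move: f; apply: (ev_X_eq0 (raddfD (@Sq k a))) => I m.
  rewrite mpolyXn -mpolyXD /=; move: (_ + _)%MM => {I}m.
  have [->|m0] := eqVneq m 0%MM; first by rewrite mpolyX0 Sq_1 ?raddf0.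
  have [i [m' ->]] := mnm_factor m0; rewrite mpolyXD; move: 'X_[m'] => f.
  (* Sq^(a+1) is compared on x_i f and on g_i f: after the prescription, the
     values of top on the former and of X i on the latter differ by that of top
     on a multiple of x_i + g_i, the sum of all variables, which top kills. *)
  case: a a0 => // a _; rewrite (Sq_total_linear _ (Sq_totalX i)).
  have lT : linform setT = 'X_i + g i :> P k.
    by rewrite /g -setTD /linform (big_setD1 i) ?inE.
  have E1 := (DX i).2 a.+1 (g i * f) isT.
  rewrite (Sq_total_linear _ (Sq_linform _)) raddfD /= in E1.
  have := topT ('X_i * Sq a f); rewrite mulrCA topE lT mulrDl mulrDr raddfD /= => E2.
  rewrite raddfD /= expr2 -mulrA !topE.
  move/eqP: E2; rewrite addF2_eq0 => /eqP ->.
  by rewrite mulrA -expr2.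
exists F; split=> // S.
  by rewrite /F; case: eqVneq => // _ [].
rewrite /F; case: eqVneq => // ST; apply: dual_by_support.
by rewrite sE -ltnS prednK // card_proper.
Qed.

(** * Decomposition into spreads *)

(** Both sides have the same strands along all words of length s. *)
Lemma dual_decomposition : (k.-1 <= s)%N -> (k <= s)%N || (0 < n)%N ->
  exists psi : {set 'I_k} -> functional k,
    [/\ forall J, QP_dual n (psi J), forall J, kills_form J (psi J)
      & forall m, phi0 m = \sum_(J | J != set0) iter s (spread J) (psi J) m].
Proof.
move=> le_s dich; have [F [FE FD FB]] := complete_family le_s dich.
have Dpsi J : QP_dual n (upsum F J) by apply: dual_sum.
have kpsi J : kills_form J (upsum F J).
  by move=> v; rewrite -upsum_balance big1 // => S _; apply: FB.
exists (upsum F); split=> // m; apply/eqP; rewrite -addF2_eq0; apply/eqP.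
pose delta : functional k := fun m =>
  phi0 m + \sum_(J | J != set0) iter s (spread J) (upsum F J) m.
suff E : delta = fun=> 0 by rewrite -[_ + _]/(delta m) E.
apply: (@strands_eq0 s) => [|w sw].
  by apply: dualD => //; apply: dual_sum => J _; have [] := dual_iter_spread s (Dpsi J) (kpsi J).
apply: funext => {}m; rewrite strandsE /delta -(strandsE phi0).
rewrite (eq_bigr (fun J : {set 'I_k} =>
    if [set x in w] \subset J then upsum F J m else 0)) => [|J _]; last first.
  by rewrite -strandsE strands_iter_spread //; case: ifP.
rewrite strands_by_support //; set W := [set x in w].
have W0 : W != set0.
  case: w sw @W => [s0|x w _]; first by have := s_gt0; rewrite -s0.
  by apply/set0Pn; exists x; rewrite inE mem_head.
rewrite -FE; last first.
  case: eqVneq => [WT|]; [right | by left].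
  by rewrite -(card_ord k) -cardsT -WT -sw cardsE card_size.
rewrite -(upsumK F W m) big_mkcond [X in _ + X]big_mkcond -big_split big1 //= => J _.
have [WJ|_] := boolP (W \subset J); last by rewrite if_same addr0.
rewrite (_ : J != set0) ?addF2 //; apply: contraNneq W0 => J0.
by rewrite -subset0 -J0.
Qed.

End Decomposition.

(** * Independence of spreads *)
Section Independence.
Variables k n s : nat.
Implicit Types (m : 'X_{1..k}) (J S T : {set 'I_k}).

(** Taking strands, the hypothesis says that the upward sums of psi vanish at all
   nonempty S with at most s elements.  If s >= k, Moebius inversion concludes.
   If s = k - 1, it leaves all psi J equal; the common value is killed by every
   variable, hence vanishes in positive degree. *)
Lemma spread_independent (psi : {set 'I_k} -> functional k) :
  (0 < s)%N -> (k.-1 <= s)%N -> (k <= s)%N || (0 < n)%N ->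
  (forall J, QP_dual n (psi J)) -> (forall J, kills_form J (psi J)) ->
  (forall m, \sum_(J | J != set0) iter s (spread J) (psi J) m = 0) ->
  forall J, J != set0 -> psi J = fun=> 0.
Proof.
move=> s_gt0 le_s dich Dpsi kpsi sum0.
have up0 S m : S != set0 -> (#|S| <= s)%N -> upsum psi S m = 0.
  move=> S0 Ss; have [sz E] := wordP S0 Ss.
  rewrite -[RHS](sum0 (place (word s S) m)).
  rewrite [RHS](eq_bigr (fun J : {set 'I_k} =>
      if S \subset J then psi J m else 0)) => [|J _]; last first.
    by rewrite -strandsE strands_iter_spread // E; case: ifP.
  rewrite /upsum [LHS]big_mkcond [RHS]big_mkcond; apply: eq_bigr => J _.
  have [SJ|_] := boolP (S \subset J); last by rewrite if_same.
  rewrite (_ : J != set0) //; apply: contraNneq S0 => J0.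
  by rewrite -subset0 -J0.
have J_top J m : J != set0 -> psi J m = if (k <= s)%N then 0 else psi setT m.
  move=> J0; rewrite -(upsumK psi J m) (bigD1 setT) ?subsetT //=.
  rewrite [X in _ + X]big1 ?addr0 => [|S /andP[JS ST]]; last first.
    apply: up0; first by apply: contraNneq J0 => S0; rewrite -subset0 -S0.
    have := proper_card (_ : S \proper setT); rewrite properT cardsT card_ord => /(_ ST).
    by move: le_s; clear; lia.
  case: ifP => [ks|_].
    apply: up0; last by rewrite cardsT card_ord.
    by apply: contraNneq J0 => S0; rewrite -subset0 -S0 subsetT.
  by rewrite /upsum (big_pred1 setT) // => S; rewrite subTset.
have T0 m : ~~ (k <= s)%N -> psi setT m = 0.
  move=> ks; have n_gt0 : (0 < n)%N by move: dich; rewrite (negPf ks).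
  have [m0|m0] := eqVneq m 0%MM.
    by apply: (Dpsi setT).1; rewrite m0 mdeg0; move: n_gt0; clear; lia.
  have [i [m' ->]] := mnm_factor m0.
  have S0 : [set i] != set0 by apply/set0Pn; exists i; rewrite inE.
  have := kpsi [set i] 'X_[m']; rewrite /linform big_set1 -mpolyXD evX.
  by rewrite J_top // (negPf ks).
move=> J J0; apply: funext => m; rewrite J_top //.
by case: ifP => // /negbT; apply: T0.
Qed.

End Independence.

(** * Linear substitutions and hyperplanes *)
Lemma rmorph_eqX k (R : comNzRingType) (h1 h2 : {rmorphism P k -> R}) :
  (forall i, h1 'X_i = h2 'X_i) -> h1 =1 h2.
Proof.
move=> hX; elim/F2_mpoly_ind => [|m f IH]; first by rewrite (rmorph0 h1) (rmorph0 h2).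
rewrite (rmorphD h1) (rmorphD h2) IH; congr (_ + _).
rewrite mpolyXE_id (rmorph_prod h1) (rmorph_prod h2); apply: eq_bigr => i _.
by rewrite (rmorphXn h1) (rmorphXn h2) hX.
Qed.

Section Substitution.
Variables k1 k2 : nat.
Variable L : 'I_k1 -> {set 'I_k2}.
Implicit Types (f g : P k1) (m : 'X_{1..k1}) (phi : functional k2).

(** Substitutions of linear forms, each given as a set of variables, commute
   with the squares; so functionals of the dual pull back. *)
Definition subst f : P k2 := mmap (@mpolyC k2 'F_2) (fun i => linform (L i)) f.

HB.instance Definition _ := GRing.RMorphism.copy subst
  (mmap (@mpolyC k2 'F_2) (fun i => linform (L i))).

Lemma substX i : subst 'X_i = linform (L i).
Proof. by rewrite /subst mmapX mmap1U. Qed.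

Lemma Sq_total_subst f : Sq_total (subst f) = map_poly subst (Sq_total f).
Proof.
apply: (rmorph_eqX (h1 := @Sq_total k2 \o subst) (h2 := map_poly subst \o @Sq_total k1)).
move=> i /=; rewrite substX Sq_linform Sq_totalX [RHS]rmorphD.
rewrite [X in _ = _ + X]rmorphM /= !map_polyC map_polyX /=.
by rewrite [in RHS]rmorphXn /= substX.
Qed.

Lemma Sq_subst a f : Sq a (subst f) = subst (Sq a f).
Proof. by rewrite /Sq Sq_total_subst coef_map. Qed.

Lemma subst_homog m : subst 'X_[m] \is (mdeg m).-homog.
Proof.
rewrite mpolyXE_id rmorph_prod /= mdegE.
apply: (big_ind2 (fun (p : P k2) d => p \is d.-homog)) => [|p d q e hp hq|i _].
- exact: dhomog1.
- exact: dhomogM.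
rewrite rmorphXn /= substX -[X in X.-homog]mul1n; apply: dhomogMn.
by apply: rpred_sum => j _; rewrite dhomogX /= mdeg1.
Qed.

Definition pull phi : functional k1 := fun m => ev phi (subst 'X_[m]).

Lemma ev_pull phi f : ev (pull phi) f = ev phi (subst f).
Proof.
by apply: (ev_eqX (F := fun f => ev phi (subst f))) => // g h; rewrite !raddfD.
Qed.

Lemma ev_homog n phi (f : P k2) d : QP_dual n phi -> f \is d.-homog -> d != n -> ev phi f = 0.
Proof.
move=> [phi_n _] /dhomogP hf dn; rewrite /ev big_seq; apply: big1 => m /hf md.
by rewrite phi_n ?mulr0 // md; apply/eqP.
Qed.

Lemma dual_pull n phi : QP_dual n phi -> QP_dual n (pull phi).
Proof.
move=> D; split=> [m mn|a f a0].
  by apply: ev_homog D (subst_homog m) _; apply/eqP.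
by rewrite ev_pull -Sq_subst D.2.
Qed.

End Substitution.

Section Hyperplane.
Variables (k : nat) (j0 : 'I_k.+1) (J : {set 'I_k.+1}).
Hypothesis j0J : j0 \in J.

(** Elimination of x_j0 by the equation h_J = 0, and the renumbering of variables
   which is a section of it. *)
Definition solve (x : 'I_k.+1) : {set 'I_k} :=
  if unlift j0 x is Some a then [set a] else [set a | lift j0 a \in J].
Definition skip (a : 'I_k) : {set 'I_k.+1} := [set lift j0 a].

Lemma linform1 n (i : 'I_n) : linform [set i] = 'X_i.
Proof. by rewrite /linform big_set1. Qed.

Lemma subst_skipX a : subst skip 'X_a = 'X_(lift j0 a).
Proof. by rewrite substX linform1. Qed.

Lemma subst_solve_lift a : subst solve 'X_(lift j0 a) = 'X_a.
Proof. by rewrite substX /solve liftK linform1. Qed.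

Lemma subst_solve_j0 : subst solve 'X_j0 = \sum_(a | lift j0 a \in J) 'X_a.
Proof.
rewrite substX /solve unlift_none /linform.
by apply: eq_bigl => a; rewrite inE.
Qed.

Lemma solve_skip f : subst solve (subst skip f) = f.
Proof.
apply: (rmorph_eqX (h1 := subst solve \o subst skip) (h2 := idfun)) => a /=.
by rewrite subst_skipX subst_solve_lift.
Qed.

Lemma linform_j0 : linform J = 'X_j0 + \sum_(a | lift j0 a \in J) 'X_(lift j0 a).
Proof. by rewrite /linform (bigD1_ord j0). Qed.

Lemma kills_form_pull phi : kills_form J (pull solve phi).
Proof.
move=> v; rewrite ev_pull rmorphM /= linform_j0 rmorphD rmorph_sum /=.
rewrite subst_solve_j0; under [X in _ + X]eq_bigr do rewrite subst_solve_lift.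
by rewrite addff mul0r raddf0.
Qed.

Lemma pull_skip_solve phi : pull skip (pull solve phi) = phi.
Proof.
by apply: funext => m; rewrite /pull ev_pull solve_skip evX.
Qed.

(** Any f is congruent to skip (solve f) modulo h_J; the property is
   multiplicative in f, so it is enough to see it on variables. *)
Lemma pull_solve_skip psi : kills_form J psi -> pull solve (pull skip psi) = psi.
Proof.
move=> kJ; apply: funext => m; rewrite /pull ev_pull.
pose Q (f : P k.+1) := forall v, ev psi (subst skip (subst solve f) * v) = ev psi (f * v).
have Q1 : Q 1 by move=> v; rewrite !rmorph1.
have QM f g : Q f -> Q g -> Q (f * g).
  by move=> Qf Qg v; rewrite !rmorphM /= -mulrA Qf mulrCA Qg mulrCA mulrA.
have QX x : Q 'X_x.
  case: (unliftP j0 x) => [a ->|->] v; first by rewrite subst_solve_lift subst_skipX.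
  have := kJ v; rewrite linform_j0 mulrDl raddfD /= subst_solve_j0 rmorph_sum /=.
  under [in X in _ -> X]eq_bigr do rewrite subst_skipX.
  by move/eqP; rewrite addF2_eq0 => /eqP ->.
have Qm : Q 'X_[m].
  rewrite mpolyXE_id; apply: (big_ind Q) => [||i _]; [exact: Q1 | exact: QM |].
  elim: (m i) => [|e IH]; first by rewrite expr0; exact: Q1.
  rewrite exprS; apply: QM; [exact: QX | exact: IH].
by have := Qm 1; rewrite !mulr1 evX.
Qed.

End Hyperplane.

(** * Bases of the dual *)
Section Bases.

Definition dual_basis k n (I : finType) (B : I -> functional k) : Prop :=
  [/\ forall i, QP_dual n (B i),
      forall c : I -> 'F_2, (forall m, \sum_i c i * B i m = 0) -> forall i, c i = 0
    & forall phi, QP_dual n phi -> exists c : I -> 'F_2, forall m, phi m = \sum_i c i * B i m].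

(** Iterated spreads are linear in psi, because the monomial at which psi is
   evaluated, if any, does not depend on psi. *)
Lemma spread_at k t (J : {set 'I_k}) m :
  exists e : option 'X_{1..k}, forall psi : functional k,
    iter t (spread J) psi m = if e is Some x then psi x else 0.
Proof.
elim: t m => [|t IH] m; first by exists (Some m).
rewrite /=; have [e He] := IH (halfm m).
exists (if ~: odds m \in singles J then e else None) => psi.
by rewrite {1}/spread He; case: ifP.
Qed.

Lemma iter_spread_sum k t (J : {set 'I_k}) (I : finType) (c : I -> 'F_2)
    (F : I -> functional k) m :
  iter t (spread J) (fun x => \sum_i c i * F i x) m =
  \sum_i c i * iter t (spread J) (F i) m.
Proof.
have [e He] := spread_at t J m; rewrite He.
under eq_bigr do rewrite He.
by case: e {He} => // ; rewrite big1 // => i _; rewrite mulr0.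
Qed.

Lemma pull_sum k1 k2 (L : 'I_k1 -> {set 'I_k2}) (I : finType) (c : I -> 'F_2)
    (F : I -> functional k2) m :
  pull L (fun x => \sum_i c i * F i x) m = \sum_i c i * pull L (F i) m.
Proof. by rewrite /pull ev_sum; apply: eq_bigr => i _; rewrite ev_scale. Qed.

Definition nonempty k := {J : {set 'I_k} | J \in predC1 set0}.

Lemma card_nonempty k : #|{: nonempty k}| = (2 ^ k - 1)%N.
Proof.
have cS : #|{: {set 'I_k}}| = (2 ^ k)%N.
  by rewrite -cardsT -powersetT card_powerset cardsT card_ord.
by rewrite card_sig -cS subn1 -(cardC1 (set0 : {set 'I_k})).
Qed.

Definition pivot k (J : {set 'I_k.+1}) : 'I_k.+1 := odflt ord0 [pick x in J].

Lemma pivotP k (J : {set 'I_k.+1}) : J != set0 -> pivot J \in J.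
Proof.
rewrite /pivot => /set0Pn [x xJ]; case: pickP => [//|/(_ x)].
by rewrite xJ.
Qed.

Definition spread_family k s (I : finType) (B : I -> functional k)
    (u : nonempty k.+1 * I) : functional k.+1 :=
  iter s (spread (val u.1)) (pull (solve (pivot (val u.1)) (val u.1)) (B u.2)).

Theorem dual_basis_step k n s (I : finType) (B : I -> functional k) :
  (k <= popcount (n + k))%N -> (0 < s)%N -> (k <= s)%N ->
  (k < s)%N || (0 < n)%N -> dual_basis n B ->
  dual_basis (tower k.+1 n s) (spread_family s B).
Proof.
move=> pc s_gt0 le_s dich [BD Bfree Bspan].
have J0 (J : nonempty k.+1) : val J != set0 by case: J.
have sumE (c : nonempty k.+1 * I -> 'F_2) m :
    \sum_u c u * spread_family s B u m =
    \sum_(J : {set 'I_k.+1} | J != set0) iter s (spread J)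
      (fun x => if insub J is Some u then
         pull (solve (pivot J) J) (fun y => \sum_i c (u, i) * B i y) x else 0) m.
  transitivity (\sum_(u : nonempty k.+1) \sum_i c (u, i) * spread_family s B (u, i) m).
    by rewrite pair_bigA; apply: eq_bigr => -[].
  rewrite [RHS](eq_bigl (mem (predC1 set0))) // [RHS]big_sub; apply: eq_bigr => u _.
  rewrite valK (_ : (fun x => _) =
    (fun x => \sum_i c (u, i) * pull (solve (pivot (val u)) (val u)) (B i) x)).
    by rewrite iter_spread_sum.
  by apply: funext => x; rewrite pull_sum.
split.
- case=> u i; apply: (dual_iter_spread s _ _).1; first exact: dual_pull.
  exact/kills_form_pull/pivotP.
- move=> c sum0 [u i].
  pose psi J : functional k.+1 := fun x => if insub J is Some u then
         pull (solve (pivot J) J) (fun y => \sum_i c (u, i) * B i y) x else 0.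
  have Dpsi J : QP_dual n (psi J) /\ kills_form J (psi J).
    rewrite /psi; case: insubP => [v _ vJ|_]; last first.
      by split; [exact: dual0 | move=> v; rewrite ev_zero].
    split; last by apply/kills_form_pull/pivotP; rewrite -vJ.
    by apply: dual_pull; apply: dual_sum => x _; apply: dual_scale.
  have psi0 := spread_independent (psi := psi) s_gt0 le_s dich
     (fun J => (Dpsi J).1) (fun J => (Dpsi J).2) (fun m => esym (etrans (esym (sum0 m)) (sumE c m))).
  apply: (Bfree (fun i => c (u, i))) => m; have := psi0 _ (J0 u).
  rewrite /psi valK => E.
  rewrite -[LHS]/((fun y => \sum_i c (u, i) * B i y) m).
  rewrite -(pull_skip_solve (pivot (val u)) (val u) (fun y => \sum_i c (u, i) * B i y)).
  rewrite (_ : pull (solve _ _) _ = fun=> 0) // /pull; exact: ev_zero.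
- move=> phi Dphi.
  have [psi [Dpsi kpsi phiE]] :=
    @dual_decomposition k.+1 n s pc (ltn0Sn k) phi Dphi s_gt0 le_s dich.
  have /choice [c cE] (J : {set 'I_k.+1}) : exists c : I -> 'F_2, forall m,
      pull (skip (pivot J)) (psi J) m = \sum_i c i * B i m.
    exact/Bspan/dual_pull.
  exists (fun u => c (val u.1) u.2) => m; rewrite sumE phiE.
  apply: eq_bigr => J nJ; congr (iter _ _ _ m); apply: funext => x.
  rewrite insubT //=.
  rewrite -[psi J](pull_solve_skip (pivotP nJ) (kpsi J)).
  by congr (pull _ _ x); apply: funext => y; rewrite cE.
Qed.

End Bases.

(** * From the dual to the classes *)
Section Duality.
Variables k n : nat.
Implicit Types (f g : P k) (m : 'X_{1..k}) (phi : functional k).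

Lemma hit_dual phi f : QP_dual n phi -> hit f -> ev phi f = 0.
Proof.
move=> [_ phiS] [s as_s ->]; rewrite raddf_sum big_seq; apply: big1 => u us.
have /allP aug := allP as_s u us; rewrite /steenrod_act raddf_sum big_seq /=.
apply: big1 => w /aug; elim: w => // -[|a] w IH /= w0; last exact: phiS.
by rewrite Sq_0 IH.
Qed.

Lemma hit_Sq a f : (0 < a)%N -> hit (Sq a f).
Proof.
move=> a0; exists [:: ([:: [:: a]], f)]; first by rewrite /= addn0 a0.
by rewrite big_seq1 /steenrod_act big_seq1.
Qed.

Lemma Sq_homog a m : Sq a ('X_[m] : P k) \is (mdeg m + a).-homog.
Proof.
move: {2}(mdeg m) (erefl (mdeg m)) => d; elim: d a m => [|d IH] a m md.
  have -> : m = 0%MM by apply/eqP; rewrite -mdeg_eq0 md.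
  rewrite mdeg0 mpolyX0; case: a => [|a]; first by rewrite Sq_0 dhomog1.
  by rewrite Sq_1 // dhomog0.
have [|i [m' Em]] := @mnm_factor _ m; first by rewrite -mdeg_eq0 md.
move: md; rewrite Em mdegD mdeg1 add1n => -[md].
rewrite mpolyXD; case: a => [|a].
  by rewrite Sq_0 -mpolyXD dhomogX /= mdegD mdeg1 addn0.
have Xi : ('X_i : P k) \is 1.-homog by rewrite dhomogX /= mdeg1.
rewrite (Sq_total_linear _ (Sq_totalX i)); apply: rpredD.
  rewrite (_ : ((mdeg m').+1 + a.+1 = 1 + (mdeg m' + a.+1))%N); last by lia.
  exact: dhomogM Xi (IH _ _ md).
rewrite (_ : ((mdeg m').+1 + a.+1 = 1 * 2 + (mdeg m' + a))%N); last by lia.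
exact: dhomogM (dhomogMn 2 Xi) (IH _ _ md).
Qed.

Definition monomials := {x : 'X_{1..k < n.+1} | mdeg x == n}.
Local Notation N := #|{: monomials}|.

Definition mon (j : 'I_N) : 'X_{1..k} := val (val (enum_val j)).

Lemma mon_deg j : mdeg (mon j) = n.
Proof. exact/eqP/(valP (enum_val j)). Qed.

Lemma mon_surj m : mdeg m = n -> exists j, m = mon j.
Proof.
move=> md; have lt_m : (mdeg m < n.+1)%N by rewrite md.
have md' : mdeg (BMultinom lt_m) == n by rewrite md.
exists (enum_rank (Sub (BMultinom lt_m) md' : monomials)).
by rewrite /mon enum_rankK.
Qed.

Lemma mon_inj : injective mon.
Proof. by move=> i j /val_inj /val_inj /enum_val_inj. Qed.

Definition coords f : 'rV['F_2]_N := \row_j f@_(mon j).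
Definition combine (u : 'rV['F_2]_N) : P k := \sum_j u 0 j *: 'X_[mon j].

Lemma combine_homog u : combine u \is n.-homog.
Proof.
by apply: rpred_sum => j _; apply: dhomogZ; rewrite dhomogX /= mon_deg.
Qed.

Lemma coordsK f : f \is n.-homog -> combine (coords f) = f.
Proof.
move=> /dhomogP hf; apply/mpolyP => m; rewrite raddf_sum /=.
have [md|md] := eqVneq (mdeg m) n.
  have [j ->] := mon_surj md; rewrite (bigD1 j) //= big1 => [|i ij].
    by rewrite mcoeffZ mcoeffX eqxx mulr1 addr0 mxE.
  by rewrite mcoeffZ mcoeffX (inj_eq mon_inj) (negPf ij) mulr0.
rewrite big1 => [|j _]; last first.
  rewrite mcoeffZ mcoeffX (_ : (_ == m) = false) ?mulr0 //.
  by apply: contraNF md => /eqP <-; rewrite mon_deg.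
by apply/esym/eqP; rewrite mcoeff_eq0; apply: contra md => /hf /= ->.
Qed.

Lemma coords_other f d : f \is d.-homog -> d != n -> coords f = 0.
Proof.
move=> /dhomogP hf dn; apply/rowP => j; rewrite !mxE; apply/eqP.
rewrite mcoeff_eq0; apply: contra dn => /hf /= <-; exact/eqP/mon_deg.
Qed.

Lemma combine_is_linear : linear combine.
Proof.
move=> c u v; rewrite /combine scaler_sumr -big_split; apply: eq_bigr => j _.
by rewrite !mxE scalerDl scalerA.
Qed.

HB.instance Definition _ :=
  GRing.isLinear.Build 'F_2 'rV['F_2]_N (P k) _ combine combine_is_linear.

Lemma coordsD f g : coords (f + g) = coords f + coords g.
Proof. by apply/rowP => j; rewrite !mxE mcoeffD. Qed.

Lemma ev_combine phi u : ev phi (combine u) = \sum_j u 0 j * phi (mon j).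
Proof. by rewrite raddf_sum /=; apply: eq_bigr => j _; rewrite linearZ /= evX. Qed.

(** If the coordinates of f lay outside the span H of those of the hit
   polynomials, some column of cokermx H would be a functional of the dual that
   does not vanish on f. *)
Lemma dual_detects f : f \is n.-homog ->
  (forall phi, QP_dual n phi -> ev phi f = 0) -> hit f.
Proof.
move=> hf f0; pose H := (\sum_(u : 'rV['F_2]_N | hit_pred (combine u)) <<u>>)%MS.
have hitH u : (u <= H)%MS -> hit (combine u).
  move=> /sub_sumsmxP [u_ ->]; rewrite raddf_sum /=; apply/asboolP.
  have [hit0 hitP] := @hit_submod_closed k.
  apply: (big_ind (fun f => @hit_pred k f)) => [|f1 f2 h1 h2|v hv].
  - exact: hit0.
  - by rewrite -[f1]scale1r; apply: hitP.
  have /sub_rVP [c ->] : (u_ v *m <<v>>%MS <= v)%MS.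
    by apply: submx_trans (submxMl _ _) _; rewrite genmxE.
  by rewrite linearZ /= -[_ *: _]addr0; apply: hitP.
rewrite -(coordsK hf); apply: hitH; rewrite submxE; apply/eqP/rowP => j.
pose phi : functional k := fun m => (coords 'X_[m] *m cokermx H) 0 j.
have evphi g : ev phi g = (coords g *m cokermx H) 0 j.
  apply: (ev_eqX (F := fun g => (coords g *m cokermx H) 0 j)) => // g1 g2.
  by rewrite coordsD mulmxDl mxE.
rewrite -evphi mxE; apply: f0; split=> [m mn|a g a0].
  rewrite /phi (coords_other (d := mdeg m)) ?mul0mx ?mxE ?dhomogX //.
  exact/eqP.
move: g; apply: (ev_X_eq0 (raddfD (@Sq k a))) => I m /=.
rewrite mpolyXn -mpolyXD; move: (_ + _)%MM => {I}m; rewrite evphi.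
have hS := Sq_homog a m; have [dn|dn] := eqVneq (mdeg m + a)%N n; last first.
  by rewrite (coords_other hS dn) mul0mx mxE.
rewrite dn in hS; apply/eqP.
suff : (coords (Sq a 'X_[m]) <= H)%MS by rewrite submxE => /eqP ->; rewrite mxE.
apply: (submx_trans (B := <<coords (Sq a 'X_[m])>>%MS)); first by rewrite genmxE.
by apply: (sumsmx_sup (coords (Sq a 'X_[m]))) => //; rewrite coordsK //; apply/asboolP/hit_Sq.
Qed.

Lemma dual_basis_polys (I : finType) (B : I -> functional k) : dual_basis n B ->
  exists p : I -> P k, (forall i, p i \is n.-homog) /\
    (forall i j, ev (B i) (p j) = (i == j)%:R).
Proof.
case=> BD Bfree _; pose A := \matrix_(i < #|I|, j < N) B (enum_val i) (mon j).
have Afree : row_free A.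
  rewrite -kermx_eq0; apply/eqP/row_matrixP => r; rewrite row0.
  have : row r (kermx A) *m A = 0 by rewrite -row_mul mulmx_ker row0.
  move: (row r _) => u uA.
  apply/rowP => i; rewrite [RHS]mxE.
  have c0 : forall m, \sum_x u 0 (enum_rank x) * B x m = 0.
    move=> m; have [md|md] := eqVneq (mdeg m) n; last first.
      by apply: big1 => x _; rewrite (BD x).1 ?mulr0 //; apply/eqP.
    have [j ->] := mon_surj md.
    rewrite (reindex (enum_val : 'I_#|I| -> I)) /=; last exact: onW_bij (enum_val_bij _).
    have /rowP/(_ j) := uA; rewrite !mxE => E; rewrite -[RHS]E; apply: eq_bigr => x _.
    by rewrite enum_valK mxE.
  by have := Bfree _ c0 (enum_val i); rewrite enum_valK.
exists (fun x => combine (col (enum_rank x) (pinvmx A))^T); split=> [x|x y].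
  exact: combine_homog.
have := mulmxVp Afree => /matrixP/(_ (enum_rank x) (enum_rank y)).
rewrite !mxE (inj_eq enum_rank_inj) => <-; rewrite ev_combine; apply: eq_bigr => j _.
by rewrite !mxE enum_rankK mulrC.
Qed.

Lemma QP_class0 : QP_class (0 : P k) = 0.
Proof. by apply: (addrI (QP_class 0)); rewrite -QP_classD !addr0. Qed.

Lemma QP_class_sum (T : finType) (c : T -> 'F_2) (p : T -> P k) :
  \sum_i c i *: QP_class (p i) = QP_class (\sum_i c i *: p i).
Proof.
elim/big_rec2: _ => [|i x y _ ->]; first by rewrite QP_class0.
by rewrite QP_classD; congr (_ + _); apply: QP_scale_class.
Qed.

Theorem dual_basis_dim (I : finType) (B : I -> functional k) :
  dual_basis n B -> has_dim (@QP_deg k n) #|I|.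
Proof.
move=> BB; have [p [hp Bp]] := dual_basis_polys BB; case: BB => BD Bfree Bspan.
have sumI (c : I -> 'F_2) : \sum_(i < #|I|) c (enum_val i) *: QP_class (p (enum_val i)) =
    QP_class (\sum_x c x *: p x).
  rewrite -QP_class_sum [RHS](reindex (enum_val : 'I_#|I| -> I)) //=.
  exact: onW_bij (enum_val_bij _).
have evsum (c : I -> 'F_2) x : ev (B x) (\sum_y c y *: p y) = c x.
  rewrite raddf_sum /= (bigD1 x) //= big1 => [|y yx].
    by rewrite linearZ /= Bp eqxx mulr1 addr0.
  by rewrite linearZ /= Bp eq_sym (negPf yx) mulr0.
exists (fun i => QP_class (p (enum_val i))); split=> [i|c c0 i|q [f hf ->]].
- by exists (p (enum_val i)).
- pose c' x := c (enum_rank x).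
  have E : QP_class (\sum_x c' x *: p x) = QP_class 0.
    rewrite -sumI QP_class0 -[RHS]c0; apply: eq_bigr => x _.
    by rewrite /c' enum_valK.
  move/QP_classP: E => /(hit_dual (BD (enum_val i))).
  by rewrite subr0 evsum /c' enum_valK.
- exists (fun i => ev (B (enum_val i)) f).
  rewrite (sumI (fun x => ev (B x) f)); apply/QP_classP; apply: dual_detects.
    apply: rpredB => //; apply: rpred_sum => x _; exact: dhomogZ.
  move=> phi /Bspan [c cE].
  rewrite (ev_ext cE) ev_sum; apply: big1 => x _.
  by rewrite ev_scale raddfB /= evsum subrr mulr0.
Qed.

End Duality.

(** * The dimension *)
Lemma towerE k n t : tower k n t = (k.-1 * (2 ^ t - 1) + 2 ^ t * n)%N.
Proof.
elim: t => [|t IH]; first by rewrite /tower mul1n muln0.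
have := expn_gt0 2 t; rewrite towerS IH expnS; nia.
Qed.

Definition origin_functional : unit -> functional 1 := fun _ m => (m == 0%MM)%:R.

Lemma dual_basis_origin : dual_basis 0 origin_functional.
Proof.
have D0 u : QP_dual 0 (origin_functional u).
  split=> [m /eqP|a f a0]; first by rewrite /origin_functional mdeg_eq0 => /negPf ->.
  move: f; apply: (ev_X_eq0 (raddfD (@Sq 1 a))) => I m /=.
  rewrite mpolyXn -mpolyXD; move: (_ + _)%MM => x.
  rewrite /ev big_seq; apply: big1 => y; have /dhomogP h := Sq_homog a x.
  move/h => /= dy; rewrite /origin_functional -mdeg_eq0 dy.
  by rewrite (_ : (_ == 0)%N = false) ?mulr0 //; lia.
split=> // [c c0 []|phi [phi0 _]].
  have := c0 0%MM; rewrite (big_pred1 tt) => [|[] //].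
  by rewrite /origin_functional eqxx mulr1.
exists (fun=> phi 0%MM) => m; rewrite (big_pred1 tt) => [|[] //].
rewrite /origin_functional; case: eqVneq => [->|m0]; first by rewrite mulr1.
by rewrite mulr0 phi0 //; apply/eqP; rewrite mdeg_eq0.
Qed.

Local Close Scope ring_scope.

Theorem corollary1p6 (k n : nat) (d : nat -> nat)
    (d_gt0 : forall i : nat, (1 <= i <= k - 1)%N -> (0 < d i)%N)
    (nE : n = (\sum_(1 <= i < k) (2 ^ d i - 1))%N)
    (d12 : (d 2 + 2 <= d 1)%N)
    (d_gap : forall i : nat,
        (3 <= i <= k - 1)%N -> (d i + (i - 1) <= d (i - 1))%N)
    (d_last : (k - 1 <= d (k - 1))%N)
    (k_ge3 : (2 <= k - 1)%N) :
  has_dim (@QP_deg k n) (\prod_(1 <= i < k.+1) (2 ^ i - 1))%N.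
Proof.
(* The convention d_k = 0. *)
pose D i := if i < k then d i else 0.
have gap j : 1 <= j < k -> D j.+1 + maxn 2 j <= D j.
  move=> /andP[j1 jk]; rewrite /D jk.
  have [j2|j2] := ltnP 1 j; last first.
    have -> : j = 1 by lia.
    by rewrite ifT //; lia.
  have [jk'|jk'] := ltnP j.+1 k; first by have := d_gap j.+1; rewrite !subn1 /=; lia.
  have -> : j = k - 1 by lia.
  by lia.
(* The degrees in j variables from which n = N k is reached. *)
pose N j := \sum_(1 <= i < j) (2 ^ (D i - D j) - 1).
have mono i j : 1 <= i -> i <= j -> j <= k -> D j <= D i.
  move=> i1; elim: j => [|j IH] ij jk; first by have -> : i = 0 by lia.
  have [->//|ij'] := eqVneq i j.+1.
  apply: leq_trans (IH _ _); [|lia|lia].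
  by have := gap j; lia.
have NS j : 1 <= j < k -> N j.+1 = tower j.+1 (N j) (D j - D j.+1).
  move=> jk; rewrite towerE /N big_nat_recr /=; last by lia.
  have -> : \sum_(1 <= i < j) (2 ^ (D i - D j.+1) - 1) =
      \sum_(1 <= i < j) (2 ^ (D j - D j.+1) * (2 ^ (D i - D j) - 1) + (2 ^ (D j - D j.+1) - 1)).
    apply: eq_big_nat => i /andP[i1 ij].
    have -> : D i - D j.+1 = (D j - D j.+1) + (D i - D j).
      by have := mono i j; have := mono j j.+1; lia.
    rewrite expnD mulnBr muln1 addnBA ?expn_gt0 // subnK //.
    by rewrite leq_pmulr // expn_gt0.
  rewrite big_split /= -big_distrr /= sum_nat_const_nat.
  rewrite -addnA [RHS]addnC; congr (_ + _).
  by rewrite -mulSnr subn1 prednK //; case/andP: jk.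
have main j : 1 <= j <= k -> [/\ popcount (N j + j) = j, 1 < j -> 0 < N j &
    exists (I : finType) (B : I -> functional j),
      #|I| = \prod_(1 <= i < j.+1) (2 ^ i - 1) /\ dual_basis (N j) B].
  elim: j => // -[_ _|j IH jk].
    rewrite /N big_geq //; split=> //.
    exists unit, origin_functional; split; last exact: dual_basis_origin.
    by rewrite card_unit big_nat1.
  have jk' : 1 <= j.+1 < k by lia.
  have [pc Npos [I [B [cI BB]]]] := IH ltac:(lia).
  have g := gap _ jk'.
  have s2 : maxn 2 j.+1 <= D j.+1 - D j.+2 by lia.
  rewrite NS //; set s := D j.+1 - D j.+2 in s2 *.
  split.
  - have -> : tower j.+2 (N j.+1) s + j.+2 = (2 ^ s.-1 * (N j.+1 + j.+1)).*2.+1.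
      have -> : s = s.-1.+1 by lia.
      by rewrite towerE expnS /=; have := expn_gt0 2 s.-1; nia.
    by rewrite popcount_doubleS popcount_exp pc.
  - have : 2 ^ 1 <= 2 ^ s by rewrite leq_exp2l //; lia.
    by rewrite towerE /=; nia.
  - exists _, (spread_family s B); split; last first.
      have dich : (j.+1 < s) || (0 < N j.+1).
        by have [/Npos ->|j1] := ltnP 1 j.+1; [rewrite orbT | apply/orP; left; lia].
      by apply: dual_basis_step; rewrite ?pc //; lia.
    by rewrite card_prod card_nonempty cI [RHS]big_nat_recr //= mulnC.
have [_ _ [I [B [cI BB]]]] := main k ltac:(lia).
have -> : n = N k.
  rewrite nE /N /D ltnn; apply: eq_big_nat => i /andP[_ ->].
  by rewrite subn0.
by rewrite -cI; apply: dual_basis_dim BB.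
Qed.
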